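(* Let $G = \operatorname{PSL}(3,3)$. (a) If the Zassenhaus Conjecture holds for $G$, then a weak Sylow like theorem holds in $\mathrm{V}(\mathbb{Z}G)$; that is, for each prime $p$, each finite $p$-subgroup of $\mathrm{V}(\mathbb{Z}G)$ is isomorphic to a $p$-subgroup of $G$. (b) There exists a subgroup $U \leq \mathrm{V}(\mathbb{Q}G)$ such that $U$ is isomorphic to an elementary-abelian $3$-group of order $27$ and every non-trivial element of $U$ has integral partial augmentations at all conjugacy classes of elements of order $3$ of $G$ and vanishing partial augmentations at all other conjugacy classes of $G$.
   Context: For $R \in \{\mathbb{Z}, \mathbb{Q}\}$ and a finite group $G$, $RG$ denotes the group ring and $\mathrm{V}(RG)$ the group of units of $RG$ of augmentation $1$; $G$ is regarded as a subgroup of $\mathrm{V}(RG)$. The Zassenhaus Conjecture holds for $G$ if every unit of finite order in $\mathrm{V}(\mathbb{Z}G)$ is conjugate, by a unit of $\mathbb{Q}G$, to an element of $G$. For $u = \sum_{g \in G} z_g g \in \mathbb{Q}G$ and $x \in G$ with conjugacy class $x^G$, the partial augmentation of $u$ at $x^G$ is $\varepsilon_x(u) = \sum_{g \in x^G} z_g$. *)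

(* Defs.v *)
From HB Require Import structures.
From mathcomp Require Import all_boot all_order all_algebra all_fingroup.
From mathcomp Require Import all_solvable.
From mathcomp Require Import finmap.
From mathcomp Require Import boolp.

Set Implicit Arguments.
Unset Strict Implicit.
Unset Printing Implicit Defensive.

Import GRing.Theory.
Local Open Scope ring_scope.

(* The product on {ffun gT -> R} inherited from R is pointwise; the alias      *)
(* group_ring gT R carries the convolution product instead.                    *)
Definition group_ring (gT : finGroupType) (R : nzRingType) : Type :=
  {ffun gT -> R}.

Section GroupRing.
Variables (gT : finGroupType) (R : nzRingType).
Implicit Types u v w : group_ring gT R.

HB.instance Definition _ :=
  GRing.Zmodule.copy (group_ring gT R) {ffun gT -> R}.

Definition gr_of (g : gT) : group_ring gT R := [ffun h => (h == g)%:R].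

Definition gr_mul u v : group_ring gT R :=
  [ffun g => \sum_(h : gT) u h * v (h^-1 * g)%g].

Fact gr_mulA : associative gr_mul.
Proof.
move=> u v w; apply/ffunP=> g; rewrite !ffunE.
under eq_bigr => k _ do rewrite ffunE mulr_sumr.
under [RHS]eq_bigr => h _ do rewrite ffunE mulr_suml.
rewrite [RHS]exchange_big /=; apply: eq_bigr => k _.
rewrite [RHS](reindex_inj (mulgI k)) /=; apply: eq_bigr => h _.
by rewrite mulKg invMg mulgA mulrA.
Qed.

Fact gr_mul1l : left_id (gr_of 1%g) gr_mul.
Proof.
move=> u; apply/ffunP=> g; rewrite ffunE (bigD1 1%g) //= big1 => [|h /negPf h1].
  by rewrite ffunE eqxx mul1r invg1 mul1g addr0.
by rewrite ffunE h1 mul0r.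
Qed.

Fact gr_mul1r : right_id (gr_of 1%g) gr_mul.
Proof.
move=> u; apply/ffunP=> g; rewrite ffunE (bigD1 g) //= big1 => [|h /negPf hg].
  by rewrite ffunE mulVg eqxx mulr1 addr0.
by rewrite ffunE -eq_mulVg1 hg mulr0.
Qed.

Fact gr_mulDl : left_distributive gr_mul +%R.
Proof.
move=> u v w; apply/ffunP=> g; rewrite !ffunE -big_split /=.
by apply: eq_bigr => h _; rewrite ffunE mulrDl.
Qed.

Fact gr_mulDr : right_distributive gr_mul +%R.
Proof.
move=> u v w; apply/ffunP=> g; rewrite !ffunE -big_split /=.
by apply: eq_bigr => h _; rewrite ffunE mulrDr.
Qed.

Fact gr_oner_neq0 : gr_of 1%g != 0 :> group_ring gT R.
Proof.
apply/eqP=> /ffunP/(_ 1%g); rewrite !ffunE eqxx => /eqP.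
by rewrite oner_eq0.
Qed.

HB.instance Definition _ := GRing.Zmodule_isNzRing.Build (group_ring gT R)
  gr_mulA gr_mul1l gr_mul1r gr_mulDl gr_mulDr gr_oner_neq0.

Lemma gr_ofM g h : gr_of (g * h)%g = gr_of g * gr_of h.
Proof.
apply/ffunP=> k; rewrite !ffunE (bigD1 g) //= big1 => [|l /negPf lg].
  by rewrite !ffunE eqxx mul1r addr0 -[in RHS](inj_eq (mulgI g)) mulKVg.
by rewrite ffunE lg mul0r.
Qed.

Definition augmentation u : R := \sum_(g : gT) u g.

Lemma augmentation1 : augmentation 1 = 1.
Proof.
rewrite /augmentation (bigD1 1%g) //= big1 ?ffunE ?eqxx ?addr0 // => h /negPf h1.
by rewrite ffunE h1.
Qed.

Lemma augmentationM u v : augmentation (u * v) = augmentation u * augmentation v.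
Proof.
rewrite /augmentation mulr_suml; under eq_bigr do rewrite ffunE.
rewrite exchange_big /=; apply: eq_bigr => h _.
rewrite mulr_sumr (reindex_inj (mulgI h)) /=.
by apply: eq_bigr => g _; rewrite mulKg.
Qed.

Definition gr_is_inverse u v := v * u = 1 /\ u * v = 1.

Definition gr_unit : pred (group_ring gT R) :=
  fun u => `[< exists v, gr_is_inverse u v >].

Definition gr_inv u : group_ring gT R :=
  if pselect (exists v, gr_is_inverse u v) is left ex then projT1 (cid ex)
  else u.

Fact gr_invP u : gr_unit u -> gr_is_inverse u (gr_inv u).
Proof.
by move=> /asboolP uU; rewrite /gr_inv; case: pselect => // ex; case: (cid ex).
Qed.

Fact gr_mulVr : {in gr_unit, left_inverse 1 gr_inv *%R}.
Proof. by move=> u /gr_invP[]. Qed.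

Fact gr_divrr : {in gr_unit, right_inverse 1 gr_inv *%R}.
Proof. by move=> u /gr_invP[]. Qed.

Fact gr_unitP u v : v * u = 1 /\ u * v = 1 -> gr_unit u.
Proof. by move=> uv; apply/asboolP; exists v. Qed.

Fact gr_inv_out : {in [predC gr_unit], gr_inv =1 id}.
Proof.
by move=> u /asboolPn uNU; rewrite /gr_inv; case: pselect => // /uNU.
Qed.

HB.instance Definition _ := GRing.NzRing_hasMulInverse.Build (group_ring gT R)
  gr_mulVr gr_divrr gr_unitP gr_inv_out.

Definition partial_augmentation (x : gT) u : R :=
  \sum_(g in (x ^: [set: gT])%g) u g.

Record normalized_unit : predArgType := NormalizedUnit {
  nu_val :> group_ring gT R;
  _ : (nu_val \is a GRing.unit) && (augmentation nu_val == 1)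
}.

HB.instance Definition _ := [isSub for nu_val].
HB.instance Definition _ := [Choice of normalized_unit by <:].

Implicit Types a b c : normalized_unit.

Lemma nu_unit a : nu_val a \is a GRing.unit.
Proof. by case: a => u /= /andP[]. Qed.

Lemma nu_aug a : augmentation a = 1.
Proof. by case: a => u /= /andP[_ /eqP]. Qed.

Fact nu_one_subproof :
  ((1 : group_ring gT R) \is a GRing.unit) && (augmentation 1 == 1).
Proof. by rewrite unitr1 augmentation1 eqxx. Qed.

Fact nu_mul_subproof a b : (nu_val a * nu_val b \is a GRing.unit) &&
  (augmentation (nu_val a * nu_val b) == 1).
Proof. by rewrite unitrMl ?nu_unit // augmentationM !nu_aug mulr1 eqxx. Qed.

Fact nu_inv_subproof a : ((nu_val a)^-1 \is a GRing.unit) &&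
  (augmentation (nu_val a)^-1 == 1).
Proof.
rewrite unitrV nu_unit /=; apply/eqP.
have := augmentationM (nu_val a) (nu_val a)^-1.
by rewrite divrr ?nu_unit // augmentation1 nu_aug mul1r.
Qed.

Definition nu_one := NormalizedUnit nu_one_subproof.
Definition nu_mul a b := NormalizedUnit (nu_mul_subproof a b).
Definition nu_inv a := NormalizedUnit (nu_inv_subproof a).

Fact nu_mulA : associative nu_mul.
Proof. by move=> a b c; apply: val_inj; rewrite /= mulrA. Qed.

Fact nu_mul1l : left_id nu_one nu_mul.
Proof. by move=> a; apply: val_inj; rewrite /= mul1r. Qed.

Fact nu_mul1r : right_id nu_one nu_mul.
Proof. by move=> a; apply: val_inj; rewrite /= mulr1. Qed.

Fact nu_mulVl : left_inverse nu_one nu_inv nu_mul.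
Proof. by move=> a; apply: val_inj; rewrite /= mulVr ?nu_unit. Qed.

Fact nu_mulVr : right_inverse nu_one nu_inv nu_mul.
Proof. by move=> a; apply: val_inj; rewrite /= divrr ?nu_unit. Qed.

HB.instance Definition _ := isGroup.Build normalized_unit
  nu_mulA nu_mul1l nu_mul1r nu_mulVl nu_mulVr.

End GroupRing.

Arguments gr_of {gT} R g.
Arguments normalized_unit gT R : clear implicits.

Definition gr_map (gT : finGroupType) (R S : nzRingType) (f : R -> S)
  (u : group_ring gT R) : group_ring gT S := [ffun g => f (u g)].

Definition zassenhaus_conjecture (gT : finGroupType) : Prop :=
  forall u : normalized_unit gT int,
    (exists2 n : nat, (0 < n)%N & (u ^+ n = 1)%g) ->
  exists w : group_ring gT rat, w \is a GRing.unit /\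
    exists g : gT, w^-1 * gr_map (intr : int -> rat) u * w = gr_of rat g.

(* An isomorphism from a finite subgroup U of a possibly infinite group onto a *)
(* subgroup P of a finite group; only the values of f on U matter.             *)
Definition fsubgroup_isog (V : groupType) (hT : finGroupType)
    (U : {fset V}) (P : {group hT}) : Prop :=
  exists f : V -> hT,
    [/\ {in U &, {morph f : x y / (x * y)%g}},
        {in U &, injective f},
        (forall x, x \in U -> f x \in P)
      & (forall y, y \in P -> exists2 x, x \in U & f x = y)].

Definition weak_sylow_like (gT : finGroupType) : Prop :=
  forall p : nat, prime p ->
  forall U : {fset normalized_unit gT int},
    group_closed [in U] -> (p.-nat #|` U|)%N ->
  exists2 P : {group gT}, (p.-group P)%g & fsubgroup_isog U P.

Section PSL.
Variables (n : nat) (F : finFieldType).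

Definition SL_set : {set {'GL_n[F]}} := [set u | \det (GLval u) == 1].

Fact SL_group_set : group_set SL_set.
Proof.
apply/group_setP; split=> [|u v]; rewrite !inE ?GL_1E ?det1 //.
by move=> /eqP du /eqP dv; rewrite GL_ME [\det _]det_mulmx du dv mulr1.
Qed.

Definition SL : {group {'GL_n[F]}} := Group SL_group_set.

Definition PSL : finGroupType := [subg (SL / 'Z(SL))%G].
End PSL.

(* Main.v *)
Require Import Defs.
From HB Require Import structures.
From mathcomp Require Import all_boot all_order all_algebra all_fingroup.
From mathcomp Require Import all_solvable.
From mathcomp Require Import finmap.
From mathcomp Require Import mxabelem ring.

Set Implicit Arguments.
Unset Strict Implicit.
Unset Printing Implicit Defensive.
Import GRing.Theory Num.Theory.

(** Let G = PSL(3,3), which is SL(3,3) because only the scalar 1 has determinant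
    one over F_3, and let rho be its natural representation on F_3^3.

    Part (a).  Under the Zassenhaus conjecture each unit u of a finite
    subgroup U of V(ZG) is rationally conjugate to some c(u) in G, so the
    partial augmentations of u are those of c(u), and every class function on
    G, with values in any abelian group, extends linearly to ZG and takes the
    same value at u and at c(u) ([rat_conj_classfun]).  This is used for two
    kinds of traces.

    If U is a p-group with p <> 3, rho extends to a ring map from ZG to the
    3 x 3 matrices over F_3, whose trace at u is the trace of rho (c(u)).  On U,
    compose with A |-> det(A) A, which lands in SL(3,3).  If u is in the kernel
    then its image is scalar, so the traces of rho (c(u)) and rho (c(u)^2)
    vanish; by Cayley-Hamilton in characteristic 3 this forces c(u)^3 = 1
    ([cube_eq1_F3]), hence u^3 = 1 and u = 1.  Thus U embeds in G.

    If U is a 3-group, let G act on a finite set: averaging over U gives an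
    idempotent rational matrix, whose trace is a rank, so the order of U
    divides the sum over U of the numbers of fixed points of c(u)
    ([dvdn_sum_card_fix]).  The regular action bounds the order of U by 27.
    In the action on F_3^3, nontrivial 3-elements have 3 or 9 fixed vectors,
    and no assignment of such values to an elementary abelian group of order
    27 satisfies the divisibility for all its subgroups
    ([no_rank3_fix_counts]).  The same lemma applied to a Sylow 3-subgroup of
    G shows that this one is not abelian.  Both have exponent 3, so U is either
    elementary abelian of order at most 9 or extraspecial of order 27 and
    exponent 3, and it embeds in a Sylow 3-subgroup of G.

    Part (b).  Let N be the elementary abelian group of the nine matrices n(v)
    with rows (1, v), (0, 1, 0), (0, 0, 1), where v is in F_3^2, and let
    L_1, ..., L_4 be its subgroups of order 3.  The primitive
    rational idempotents of QN are e_0 = avg(N) and e_i = avg(L_i) - avg(N),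
    where avg(H) is the average of the elements of H.  Choose conjugate
    elements g_i of order 3 normalizing N and acting trivially modulo L_i, say
    g_i = g^(h_i) with h_i normalizing N, and put
      t = e_0 g + e_1 g_1 + ... + e_4 g_4.
    Then t commutes with N and t^3 = 1, so U = <N, t> is elementary abelian of
    order 27.  For k = 1, 2 all elements of G involved in n t^k have order 3,
    and the partial augmentation at a class C is
      sum_i |C cap L_i n g_i^k| / 3 - |C cap N g^k| / 3,
    because the sets N g_i^k are conjugate to N g^k.  Since N fuses each coset
    of L_i contained in N g_i^k into one class, both counts are divisible by
    3 ([partial_augmentation_line_unit]). *)

(** * Finite subgroups of arbitrary groups *)

Local Open Scope group_scope.

Section FsetGroup.
Local Open Scope fset_scope.
Variables (V : groupType) (U : {fset V}) (clU : group_closed [in U]).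

(** A synonym of the subtype U carrying the group law of V, so that the theory
    of finite groups applies to finite subgroups of infinite groups. *)
Definition fset_group of group_closed [in U] := U : Type.
Local Notation gU := (fset_group clU).
HB.instance Definition _ := Finite.on gU.

Fact fset_group1 : (1%g : V) \in U.
Proof. by have [] := clU. Qed.
Fact fset_groupV (x : gU) : (val x)^-1%g \in U.
Proof. exact: (group_closedV clU (fsvalP x)). Qed.
Fact fset_groupM (x y : gU) : (val x * val y)%g \in U.
Proof. exact: (group_closedM clU (fsvalP x) (fsvalP y)). Qed.
Definition fset_one : gU := [` fset_group1].
Definition fset_inv (x : gU) : gU := [` fset_groupV x].
Definition fset_mul (x y : gU) : gU := [` fset_groupM x y].
Fact fset_mulA : associative fset_mul.
Proof. by move=> x y z; apply: val_inj; rewrite /= mulgA. Qed.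
Fact fset_mul1 : left_id fset_one fset_mul.
Proof. by move=> x; apply: val_inj; rewrite /= mul1g. Qed.
Fact fset_mulV : left_inverse fset_one fset_inv fset_mul.
Proof. by move=> x; apply: val_inj; rewrite /= mulVg. Qed.
HB.instance Definition _ := Finite_isGroup.Build gU fset_mulA fset_mul1 fset_mulV.
End FsetGroup.

Lemma fsubgroup_isogP (V : groupType) (U : {fset V}) (clU : group_closed [in U])
    (gT : finGroupType) (f : {morphism [set: fset_group clU] >-> gT}) :
  'injm f -> fsubgroup_isog U (f @* [set: fset_group clU]).
Proof.
move=> injf; pose F (x : V) := if insub x is Some y then f (y : fset_group clU) else 1%g.
have FE (y : fset_group clU) : F (val y) = f y.
  by rewrite /F valK.
pose S z (zU : z \in U) : fset_group clU := FSetSub zU.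
exists F; split.
- move=> x y xU yU; rewrite (_ : x * y = val ((S _ xU) * (S _ yU)))%g //.
  rewrite FE morphM ?inE //.
  by rewrite -!FE.
- move=> x y xU yU; have := FE (S _ xU); have := FE (S _ yU) => /= -> -> eqf.
  by have /(congr1 val) := injmP injf _ _ (in_setT _) (in_setT _) eqf.
- by move=> x xU; rewrite (FE (S _ xU)) mem_morphim ?inE.
- by move=> _ /morphimP[y _ _ ->]; exists (val y); rewrite ?FE ?fsvalP.
Qed.

Lemma fsubgroup_isog_imfset (gT : finGroupType) (V : groupType) (phi : gT -> V) :
    {morph phi : x y / (x * y)%g} -> injective phi ->
  group_closed [in [fset phi x | x in gT]%fset] /\
  fsubgroup_isog [fset phi x | x in gT]%fset [set: gT].
Proof.
move=> phiM phiI.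
have phi1 : phi 1%g = 1%g by apply: (mulgI (phi 1%g)); rewrite -phiM !mulg1.
split.
  split=> [|_ _ /imfsetP[x _ ->] /imfsetP[y _ ->]].
    by apply/imfsetP; exists 1%g.
  apply/imfsetP; exists (x * y^-1)%g => //.
  by apply: (mulIg (phi y)); rewrite -phiM mulgKV mulgVK.
pose F v := odflt 1%g [pick x | phi x == v].
have FK : cancel phi F.
  move=> x; rewrite /F; case: pickP => [y /eqP/phiI //|/(_ x)].
  by rewrite eqxx.
exists F; split=> //.
- by move=> _ _ /imfsetP[x _ ->] /imfsetP[y _ ->]; rewrite -phiM !FK.
- by move=> _ _ /imfsetP[x _ ->] /imfsetP[y _ ->]; rewrite !FK => ->.
- by move=> x _; rewrite inE.
- by move=> y _; exists (phi y) => //; apply/imfsetP; exists y.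
Qed.

Local Close Scope group_scope.

(** * Units rationally conjugate to group elements *)

Local Open Scope ring_scope.

Lemma partial_augmentationC (gT : finGroupType) (R : comNzRingType)
    (x : gT) (u v : group_ring gT R) :
  partial_augmentation x (u * v) = partial_augmentation x (v * u).
Proof.
have E (a b : group_ring gT R) : partial_augmentation x (a * b) =
    \sum_(h : gT) \sum_(k : gT | (h * k)%g \in (x ^: [set: gT])%g) a h * b k.
  rewrite /partial_augmentation; under eq_bigr do rewrite ffunE.
  rewrite exchange_big /=; apply: eq_bigr => h _.
  by rewrite (reindex_inj (mulgI h)) /=; apply: eq_bigr => k _; rewrite mulKg.
rewrite !E (exchange_big_dep predT) //=; apply: eq_bigr => k _.
apply: eq_big => [h|h _]; last by rewrite mulrC.
have hN : h \in ('N(x ^: [set: gT]))%g by rewrite (subsetP (class_norm _ _)) ?inE.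
by rewrite -(memJ_norm (h * k)%g hN) conjgE -!mulgA mulKg.
Qed.

(** Since m may be integral and tau may take values in a module where the class
    sizes are not invertible, the sum is grouped by classes instead of being
    averaged over conjugation. *)
Lemma sum_classfun (gT : finGroupType) (A : zmodType) (tau : gT -> A)
    (m : gT -> int) :
    (forall x y, tau (x ^ y)%g = tau x) ->
  \sum_x tau x *~ m x =
    \sum_(C in classes [set: gT]) tau (repr C) *~ \sum_(x in C) m x.
Proof.
move=> tauJ; rewrite (eq_bigl (fun x => x \in [set: gT])); last by move=> x; rewrite inE.
rewrite (set_partition_big _ (classes_partition _)) /=.
apply: eq_bigr => C /imsetP[x _ ->].
rewrite mulrz_sumr; apply: eq_bigr => y /imsetP[z _ ->].
have [w _ ->] := repr_class [set: gT] x.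
by rewrite !tauJ.
Qed.

Section RationalConjugacy.
Variable gT : finGroupType.
Implicit Types (u v : group_ring gT int) (g : gT).

Definition rat_conj u g := exists2 w : group_ring gT rat,
  w \is a GRing.unit & w^-1 * gr_map intr u * w = gr_of rat g.

Lemma gr_mapM u v :
  gr_map (intr : int -> rat) (u * v) = gr_map intr u * gr_map intr v.
Proof.
apply/ffunP=> g; rewrite !ffunE rmorph_sum; apply: eq_bigr => h _.
by rewrite !ffunE rmorphM.
Qed.

Lemma gr_map1 : gr_map (intr : int -> rat) (1 : group_ring gT int) = 1.
Proof. by apply/ffunP=> g; rewrite !ffunE; case: (_ == _). Qed.

Lemma rat_conj1 : rat_conj 1 1%g.
Proof. by exists 1; rewrite ?unitr1 // gr_map1 invr1 !mulr1. Qed.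

Lemma rat_conjX u g n : rat_conj u g -> rat_conj (u ^+ n) (g ^+ n)%g.
Proof.
move=> [w wU e]; elim: n => [|n [w' _ _]]; first exact: rat_conj1.
exists w => //; elim: {w'} n.+1 => [|k IH].
  by rewrite gr_map1 mulr1 mulVr.
by rewrite exprS expgS gr_ofM -e -IH gr_mapM !mulrA mulrK.
Qed.

Lemma rat_conj_eq1 u : rat_conj u 1%g -> u = 1.
Proof.
move=> [w wU] /(congr1 (fun x => w * x * w^-1)).
rewrite !mulrA mulrV // mul1r mulrK // mulr1 mulrV // -gr_map1 => /ffunP e.
by apply/ffunP=> g; have:= e g; rewrite !ffunE => /intr_inj.
Qed.

Lemma rat_conj_partial_augmentation u g x : rat_conj u g ->
  partial_augmentation x u = (g \in x ^: [set: gT])%g%:R.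
Proof.
move=> [w wU e]; apply: (@intr_inj rat).
have -> : (partial_augmentation x u)%:~R =
    partial_augmentation x (gr_map (intr : int -> rat) u).
  by rewrite rmorph_sum; apply: eq_bigr => h _; rewrite ffunE.
have -> : gr_map intr u = w * (gr_of rat g * w^-1).
  by rewrite -e !mulrA mulrV // mul1r mulrK.
rewrite partial_augmentationC mulrVK // /partial_augmentation.
under eq_bigr do rewrite ffunE.
have [gx|gx] := boolP (g \in _).
  rewrite (bigD1 g) //= eqxx big1 ?addr0 // => h /andP[_ /negPf ->].
  by [].
rewrite big1 // => h hx; case: eqP => // hg.
by rewrite -hg hx in gx.
Qed.

Definition gr_lin (A : zmodType) (tau : gT -> A) u : A := \sum_g tau g *~ u g.

(** Only partial augmentations enter a class function, and these do not change
    under rational conjugation.  The point is that A is arbitrary: A = F_3 is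
    allowed although the conjugating unit may have denominators divisible
    by 3. *)
Lemma rat_conj_classfun (A : zmodType) (tau : gT -> A) u g :
  (forall x y, tau (x ^ y)%g = tau x) -> rat_conj u g -> gr_lin tau u = tau g.
Proof.
move=> tauJ ug; rewrite /gr_lin sum_classfun //.
rewrite (bigD1 (g ^: [set: gT])%g) ?mem_classes ?inE //= [X in _ + X]big1 ?addr0.
  rewrite -/(partial_augmentation _ _) (rat_conj_partial_augmentation _ ug) class_refl mulr1z.
  by case: (repr_class [set: gT] g) => w _ ->; rewrite tauJ.
move=> _ /andP[/imsetP[x _ ->] xg].
rewrite -/(partial_augmentation _ _) (rat_conj_partial_augmentation _ ug).
case: (boolP (g \in _)) => [/class_eqP gx|_]; last by rewrite mulr0z.
by rewrite gx eqxx in xg.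
Qed.

Section Rep.
Variables (A : comNzRingType) (n : nat) (rho : gT -> 'M[A]_n).
Hypothesis rhoM : forall x y, rho (x * y)%g = rho x *m rho y.

Lemma gr_linM u v : gr_lin rho (u * v) = gr_lin rho u *m gr_lin rho v.
Proof.
rewrite /gr_lin mulmx_suml.
under eq_bigr do rewrite ffunE mulrz_sumr.
rewrite exchange_big; apply: eq_bigr => h _ /=.
rewrite mulmx_sumr (reindex_inj (mulgI h)); apply: eq_bigr => k _ /=.
rewrite mulKg rhoM mulrzA.
by rewrite -!(scaler_int (R := A)) -scalemxAl -scalemxAr scalerA mulrC scalerA.
Qed.

Lemma gr_lin1 : gr_lin rho 1 = rho 1%g.
Proof.
rewrite /gr_lin (bigD1 1%g) //= ffunE eqxx mulr1z big1 ?addr0 // => g /negPf g1.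
by rewrite ffunE g1 mulr0z.
Qed.

Lemma mxtrace_gr_lin u g : rat_conj u g -> \tr (gr_lin rho u) = \tr (rho g).
Proof.
move=> ug; rewrite -(rat_conj_classfun (tau := fun x => \tr (rho x)) _ ug).
  by rewrite raddf_sum; apply: eq_bigr => h _; rewrite raddfMz.
move=> x y; by rewrite conjgE -?mulgA rhoM mxtrace_mulC -rhoM mulgK.
Qed.
End Rep.
End RationalConjugacy.

Section AverageTrace.
Variables (F : numFieldType) (n : nat) (hT : finGroupType) (s : hT -> 'M[F]_n).
Hypothesis sM : forall x y, s (x * y)%g = s x *m s y.

(** In a rank factorization E = C R of an idempotent, R C is the identity. *)
Lemma mxtrace_idem (E : 'M[F]_n) : E *m E = E -> \tr E = (\rank E)%:R.
Proof.
move=> EE; have e1 : row_base E *m col_base E = 1%:M.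
  apply: (row_free_inj (row_base_free E)).
  apply: (row_full_inj (col_base_full E)).
  rewrite /= mul1mx mulmxA (mulmxA (col_base E)) mulmx_base.
  by rewrite -(mulmxA E) mulmx_base EE.
by rewrite -[in LHS](mulmx_base E) mxtrace_mulC e1 mxtrace1.
Qed.

(** The average of s over H is idempotent, and k is its rank. *)
Lemma sum_mxtrace_group (H : {group hT}) :
  exists k : nat, \sum_(h in H) \tr (s h) = (#|H| * k)%:R.
Proof.
have H0 : #|H|%:R != 0 :> F by rewrite pnatr_eq0 -lt0n cardG_gt0.
pose S := \sum_(h in H) s h.
have SS : S *m S = #|H|%:R *: S.
  rewrite {1}/S mulmx_suml scaler_nat -sumr_const; apply: eq_bigr => h hH.
  rewrite mulmx_sumr /S [RHS](reindex_inj (mulgI h)).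
  by apply: eq_big => k; rewrite ?sM // groupMl.
exists (\rank (#|H|%:R^-1 *: S)); rewrite natrM -mxtrace_idem.
  by rewrite mxtraceZ mulVKf // raddf_sum.
by rewrite -scalemxAl -scalemxAr SS [X in _ *: X]scalerA mulVf // scale1r.
Qed.
End AverageTrace.

Local Close Scope ring_scope.

(** * Permutation characters of finite groups of units *)

Local Open Scope group_scope.

Lemma rat_conj_inj1 (gT : finGroupType) (g : gT) : rat_conj 1%R g -> g = 1.
Proof.
move=> [w wU]; rewrite gr_map1 mulr1 mulVr // => /ffunP/(_ g).
rewrite !ffunE eqxx; by case: eqP => // _ /eqP; rewrite ?eqxx oner_eq0.
Qed.

Section PermutationCharacter.
Variables (gT : finGroupType) (T : finType) (to : {action gT &-> T}).

Definition action_mx (R : nzRingType) (x : gT) : 'M[R]_#|T| :=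
  (\matrix_(i, j) (to (enum_val i) x == enum_val j)%:R)%R.

Lemma action_mxM (R : nzRingType) x y :
  action_mx R (x * y) = (action_mx R x *m action_mx R y)%R.
Proof.
apply/matrixP=> i j; rewrite !mxE.
rewrite (bigD1 (enum_rank (to (enum_val i) x))) //= big1 => [|k].
  by rewrite !mxE enum_rankK eqxx mul1r actM ?addr0.
move=> /eqP kN; rewrite !mxE; case: eqP => [e|_]; last by rewrite mul0r.
by case: kN; rewrite e enum_valK.
Qed.

Lemma mxtrace_action (R : nzRingType) x : (\tr (action_mx R x) = #|'Fix_to[x]|%:R)%R.
Proof.
rewrite -sum1_card natr_sum /mxtrace.
transitivity (\sum_(i < #|T|) (to (enum_val i) x == enum_val i)%:R : R)%R.
  by apply: eq_bigr => i _; rewrite mxE.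
rewrite [LHS](reindex _ (onW_bij _ (enum_rank_bij T))) /= [RHS]big_mkcond /=.
by apply: eq_bigr => t _; rewrite enum_rankK (sameP afix1P eqP); case: (_ == _).
Qed.

Lemma card_afix1J x y : #|'Fix_to[x ^ y]| = #|'Fix_to[x]|.
Proof.
apply/eqP; rewrite -(eqr_nat rat) -!mxtrace_action conjgE -?mulgA action_mxM.
by rewrite mxtrace_mulC -action_mxM mulgK.
Qed.
End PermutationCharacter.

Section UnitSubgroup.
Variables (gT hT : finGroupType) (phi : hT -> normalized_unit gT int) (c : hT -> gT).
Hypothesis phiM : {morph phi : x y / x * y}.
Hypothesis phi_inj : injective phi.
Hypothesis phi_c : forall x, rat_conj (phi x) (c x).

Lemma unit_morph1 : phi 1 = 1.
Proof. by apply: (mulgI (phi 1)); rewrite -phiM !mulg1. Qed.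

Lemma nu_val_morphX x n : nu_val (phi (x ^+ n)) = (nu_val (phi x) ^+ n)%R.
Proof.
elim: n => [|n IH]; first by rewrite expg0 unit_morph1.
by rewrite expgS phiM exprS /= IH.
Qed.

Lemma conj_classfunX (A : zmodType) (tau : gT -> A) x n :
  (forall x y, tau (x ^ y) = tau x) -> tau (c (x ^+ n)) = tau (c x ^+ n).
Proof.
move=> tauJ; rewrite -(rat_conj_classfun tauJ (phi_c _)) nu_val_morphX.
exact/(rat_conj_classfun tauJ)/rat_conjX.
Qed.

Lemma conj_expg_eq1 x n : c x ^+ n = 1 -> x ^+ n = 1.
Proof.
move=> cxn; apply: phi_inj; apply: val_inj; rewrite /= nu_val_morphX unit_morph1.
by apply: rat_conj_eq1; rewrite -cxn; apply: rat_conjX.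
Qed.

Lemma conj_expg1 x n : x ^+ n = 1 -> c x ^+ n = 1.
Proof.
move=> xn; apply: rat_conj_inj1; have := rat_conjX n (phi_c x).
by rewrite -nu_val_morphX xn unit_morph1.
Qed.

Lemma dvdn_sum_card_fix (T : finType) (to : {action gT &-> T}) (H : {group hT}) :
  #|H| %| \sum_(h in H) #|'Fix_to[c h]|.
Proof.
pose s h := gr_lin (action_mx to rat) (phi h).
have sM x y : s (x * y) = (s x *m s y)%R.
  by rewrite /s phiM gr_linM // => *; apply: action_mxM.
have [k] := sum_mxtrace_group sM H.
have -> : (\sum_(h in H) \tr (s h) = \sum_(h in H) #|'Fix_to[c h]|%:R :> rat)%R.
  apply: eq_bigr => h _.
  by rewrite (mxtrace_gr_lin (action_mxM to rat) (phi_c h)) mxtrace_action.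
by rewrite -natr_sum => /eqP; rewrite eqr_nat => /eqP->; apply: dvdn_mulr.
Qed.

(** In the regular action a nontrivial element fixes nothing, hence only the
    identity contributes, with all of G. *)
Lemma dvdn_card_unit_subgroup : #|hT| %| #|gT|.
Proof.
have := dvdn_sum_card_fix 'R%act [set: hT].
rewrite (bigD1 1) ?inE //= big1 => [|x]; last first.
  move=> /andP[_ /eqP x1]; apply: eq_card0 => y; apply/afix1P => /= /eqP.
  rewrite -[X in _ == X]mulg1 (inj_eq (mulgI y)) => /eqP cx1.
  by apply: x1; rewrite -[x]expg1 (conj_expg_eq1 (n := 1)).
rewrite addn0 cardsT; congr (_ %| _); apply: eq_card => y.
rewrite !inE sub1set inE /=.
have := conj_expg1 (x := 1) (n := 1); rewrite !expg1 => -> //.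
by rewrite mulg1 eqxx.
Qed.
End UnitSubgroup.

Local Close Scope group_scope.

(** * Rank three and fixed-point counts *)

Local Open Scope group_scope.

(** Here f abstracts the number of fixed vectors in F_3^3. *)
Section NoRankThree.
Variables (hT : finGroupType) (E : {group hT}) (f : hT -> nat).
Hypotheses (abelE : 3.-abelem E) (oE : #|E| = 27).
Hypothesis f1 : f 1 = 27.
Hypothesis f39 : {in E^#, forall x, f x = 3 \/ f x = 9}.
Hypothesis fV : {in E, forall x, f x^-1 = f x}.
Hypothesis fdvd : forall H : {group hT}, H \subset E -> #|H| %| \sum_(h in H) f h.

Lemma abelem3_inv_neq x : x \in E^# -> x^-1 != x.
Proof.
rewrite !inE => /andP[x1 xE]; apply: contraNneq x1 => e.
have := abelem_order_p abelE xE; have [->//|x1 ox] := eqVneq x 1.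
have : x ^+ 2 = 1 by rewrite expgS expg1 -{1}e mulVg.
by move/eqP; rewrite -order_dvdn ox.
Qed.

Lemma sum_cycle3 x : x \in E^# -> f x = 3 -> \sum_(z in <[x]>) f z = 33.
Proof.
move=> xE' fx; have /setD1P[x1 xE] := xE'.
have ox : #[x] = 3 by apply: (abelem_order_p abelE).
have Vx := abelem3_inv_neq xE'.
have -> : <[x]> = [set 1; x; x^-1].
  apply/eqP; rewrite eq_sym eqEcard !subUset !sub1set group1 groupV cycle_id /=.
  by rewrite -orderE ox -setUA cardsU1 cards2 !inE ![1 == _]eq_sym invg_eq1 (negPf x1) eq_sym Vx.
rewrite -setUA big_setU1 /= ?big_setU1 ?big_set1 /=; first by rewrite f1 fV ?fx.
  by rewrite inE eq_sym.
by rewrite !inE ![1 == _]eq_sym invg_eq1 (negPf x1).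
Qed.

(** With b the number of z outside <x> such that f z = 3, the sum over H is
    33 + (54 - 6 b); being divisible by 9 it forces b = 1 or b = 4.  As f is
    invariant under the fixed-point free inversion, b = 1 is impossible. *)
Lemma sum_rank2 (H : {group hT}) x :
    H \subset E -> #|H| = 9 -> x \in H^# -> f x = 3 ->
  \sum_(z in H :\: <[x]>) f z = 30.
Proof.
move=> sHE oH /setD1P[x1 xH] fx; have xE := subsetP sHE x xH.
have ox : #[x] = 3 by apply: (abelem_order_p abelE).
have sC : <[x]> \subset H by rewrite cycle_subG.
have sumC : \sum_(z in <[x]>) f z = 33 by apply: sum_cycle3; rewrite ?inE ?x1.
have oD : #|H :\: <[x]>| = 6 by rewrite cardsD (setIidPr sC) oH -orderE ox.
have := fdvd sHE; rewrite (big_setID <[x]>) /= (setIidPr sC) sumC oH.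
pose B := [set z in H :\: <[x]> | f z == 3].
have DE z : z \in H :\: <[x]> -> z \in E^#.
  rewrite !inE => /andP[zC zH]; rewrite (subsetP sHE) // andbT.
  by apply: contraNneq zC => ->; rewrite group1.
have sumD : \sum_(z in H :\: <[x]>) f z + (6 * #|B|)%N = 54.
  have -> : 54 = \sum_(z in H :\: <[x]>) 9 by rewrite sum_nat_const oD.
  rewrite -sum1_card big_distrr /= [X in _ + X](eq_bigl
    (fun z => (z \in H :\: <[x]>) && (f z == 3))) => [|z]; last by rewrite inE.
  rewrite big_mkcondr -big_split /=; apply: eq_bigr => z zD.
  by case: (f39 (DE z zD)) => ->.
have B1 : #|B| != 1%N.
  apply/negP=> /cards1P[z eB].
  have zB : z \in B by rewrite eB set11.
  have : z^-1 \in B.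
    move: (zB); rewrite !inE !groupV => /andP[/andP[-> zH] /eqP fz].
    by rewrite zH /= fV ?fz // (subsetP sHE).
  rewrite eB inE => /eqP e; have := abelem3_inv_neq (DE z _).
  by rewrite e eqxx; move: zB; rewrite inE => /andP[-> _] /(_ isT).
have Ble : #|B| <= 6 by rewrite -oD subset_leq_card //; apply/subsetP=> z; rewrite inE => /andP[].
have -> : \sum_(z in H :\: <[x]>) f z = (54 - 6 * #|B|)%N by rewrite -sumD addnK.
by move: #|B| B1 Ble => [|[|[|[|[|[|[|]]]]]]].
Qed.

(** If f x = 3 for some x, the four subgroups of order 9 containing x cover E and
    meet in <x>, so by [sum_rank2] the sum of f over E is 33 + 4 * 30 = 153.
    Otherwise it is 27 + 26 * 9 = 261.  Neither is divisible by 27. *)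
Lemma no_rank3_fix_counts : False.
Proof.
have [/existsP[x /andP[xE /eqP fx]]|no3] := boolP [exists x, (x \in E^#) && (f x == 3)].
  have /setD1P[x1 xE'] := xE.
  have ox : #[x] = 3 by apply: (abelem_order_p abelE).
  have sC : <[x]> \subset E by rewrite cycle_subG.
  pose H y := <[x]> <*> <[y]>.
  have oD : #|E :\: <[x]>| = 24 by rewrite cardsD (setIidPr sC) oE -orderE ox.
  have sH y : y \in E -> H y \subset E by rewrite join_subG sC cycle_subG.
  have oH y : y \in E :\: <[x]> -> #|H y| = 9.
    case/setDP=> yE yC; rewrite /H /= cent_joinEr; last first.
      by rewrite (sub_abelian_cent2 (abelem_abelian abelE)) ?cycle_subG.
    have oy : #[y] = 3.
      by apply: (abelem_order_p abelE) => //; apply: contraNneq yC => ->; apply: group1.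
    by rewrite TI_cardMg -?orderE ?ox ?oy // setIC prime_TIg -?orderE ?oy ?cycle_subG.
  have HE y z : y \in E :\: <[x]> -> z \in E :\: <[x]> -> (z \in H y) = (y \in H z).
    move=> yD zD; wlog suff: y z yD zD / z \in H y -> y \in H z.
      by move=> sym; apply/idP/idP; apply: sym.
    move=> zH; have /eqP-> : H z == H y.
      by rewrite eqEcard !oH // join_subG joing_subl cycle_subG zH.
    by rewrite (subsetP (joing_subr _ _)) ?cycle_id.
  have oHD y : y \in E :\: <[x]> -> #|H y :\: <[x]>| = 6.
    by move=> yD; rewrite cardsD (setIidPr (joing_subl _ _)) oH // -orderE ox.
  (* The four subgroups are counted through their generators y together with
     x: each point z outside <x> lies in H y for exactly 6 of the y. *)
  have s720 : \sum_(y in E :\: <[x]>) \sum_(z in E :\: <[x]> | z \in H y) f z = 720.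
    have -> : 720 = \sum_(y in E :\: <[x]>) 30 by rewrite sum_nat_const oD.
    apply: eq_bigr => y yD; have /setDP[yE _] := yD.
    rewrite -(@sum_rank2 (H y) x) ?sH ?oH //; last first.
      by rewrite !inE x1 (subsetP (joing_subl _ _)) ?cycle_id.
    apply: eq_bigl => z; rewrite !inE -andbA; congr (_ && _).
    exact/andb_idl/subsetP/sH.
  have s120 : \sum_(y in E :\: <[x]>) f y = 120.
    apply/eqP; rewrite -(eqn_pmul2l (m := 6)) // -[(6 * 120)%N]s720.
    rewrite (exchange_big_dep (mem (E :\: <[x]>))) /= => [|y z _ /andP[] //].
    rewrite big_distrr /=; apply/eqP/eq_bigr => z zD.
    have /setDP[zE _] := zD.
    rewrite -(oHD z zD) -sum_nat_const.
    apply: eq_bigl => y; rewrite zD /= [LHS]inE.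
    have [yD|yD] := boolP (y \in E :\: <[x]>).
      by rewrite HE //; have /setDP[_ ->] := yD.
    apply: contraNF yD => /andP[yC /(subsetP (sH z zE)) yE].
    by rewrite inE yC.
  have := fdvd (subxx E); rewrite (big_setID <[x]>) /= (setIidPr sC).
  by rewrite sum_cycle3 // s120 oE.
have f9 : {in E^#, forall x, f x = 9}.
  move=> x xE; case: (f39 xE) => // fx; case/negP: no3.
  by apply/existsP; exists x; rewrite xE fx.
have := fdvd (subxx E); rewrite (big_setD1 1) //= f1 (eq_bigr (fun=> 9)) ?sum_nat_const.
  by rewrite oE; have := cardsD1 1 E; rewrite oE group1 => /eqP; rewrite eqSS => /eqP <-.
exact: f9.
Qed.
End NoRankThree.

Local Close Scope group_scope.

(** * Three by three matrices over F_3 *)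

Local Open Scope ring_scope.

Section Matrix3.
Variable R : comNzRingType.

(** Explicit entries turn the identities below into ring identities. *)
Definition mx3 (a b c d e f g h i : R) : 'M[R]_3 := \matrix_(x, y)
  nth 0 (nth [::] [:: [:: a; b; c]; [:: d; e; f]; [:: g; h; i]] x) y.

Lemma mx3_eta (A : 'M[R]_3) :
  exists a b c d e f g h i, A = mx3 a b c d e f g h i.
Proof.
exists (A 0 0), (A 0 1), (A 0 2%:R), (A 1 0), (A 1 1), (A 1 2%:R).
exists (A 2%:R 0), (A 2%:R 1), (A 2%:R 2%:R).
by apply/matrixP=> -[[|[|[|//]]] ?] [[|[|[|//]]] ?]; rewrite mxE /=;
  congr (A _ _); apply: val_inj.
Qed.

Lemma mx3M (a b c d e f g h i a' b' c' d' e' f' g' h' i' : R) :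
  mx3 a b c d e f g h i *m mx3 a' b' c' d' e' f' g' h' i' =
  mx3 (a * a' + b * d' + c * g') (a * b' + b * e' + c * h') (a * c' + b * f' + c * i')
      (d * a' + e * d' + f * g') (d * b' + e * e' + f * h') (d * c' + e * f' + f * i')
      (g * a' + h * d' + i * g') (g * b' + h * e' + i * h') (g * c' + h * f' + i * i').
Proof.
by apply/matrixP=> -[[|[|[|//]]] ?] [[|[|[|//]]] ?];
  rewrite !mxE !big_ord_recl big_ord0 !mxE /= addr0 addrA.
Qed.

Lemma tr_mx3 (a b c d e f g h i : R) : \tr (mx3 a b c d e f g h i) = a + e + i.
Proof. by rewrite /mxtrace !big_ord_recl big_ord0 !mxE /= addr0 addrA. Qed.

Lemma det_mx3 (a b c d e f g h i : R) : \det (mx3 a b c d e f g h i) =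
  a * (e * i - f * h) - b * (d * i - f * g) + c * (d * h - e * g).
Proof.
rewrite (expand_det_row _ 0) !big_ord_recl big_ord0 /cofactor.
rewrite !(expand_det_row _ 0) !big_ord_recl !big_ord0 /cofactor !det_mx11 !mxE /=.
rewrite /bump /= !expr0 !expr1 expr2.
ring.
Qed.

Lemma mx3_scalar (a : R) : a%:M = mx3 a 0 0 0 a 0 0 0 a.
Proof.
by apply/matrixP=> -[[|[|[|//]]] ?] [[|[|[|//]]] ?]; rewrite !mxE.
Qed.

Lemma mx3B (a b c d e f g h i a' b' c' d' e' f' g' h' i' : R) :
  mx3 a b c d e f g h i - mx3 a' b' c' d' e' f' g' h' i' =
  mx3 (a - a') (b - b') (c - c') (d - d') (e - e') (f - f') (g - g') (h - h') (i - i').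
Proof.
by apply/matrixP=> -[[|[|[|//]]] ?] [[|[|[|//]]] ?]; rewrite !mxE.
Qed.

Lemma shear_conj_mx (a b : R) :
  mx3 1 a b 0 1 0 0 0 1 *m mx3 1 0 0 0 1 1 0 0 1 =
  mx3 1 0 0 0 1 1 0 0 1 *m mx3 1 a (a + b) 0 1 0 0 0 1.
Proof. by rewrite !mx3M; congr mx3; ring. Qed.

Lemma singer_conj_mx (a b : R) :
  mx3 1 a b 0 1 0 0 0 1 *m mx3 (-1) 0 0 0 0 1 0 1 1 =
  mx3 (-1) 0 0 0 0 1 0 1 1 *m mx3 1 (- b) (- (a + b)) 0 1 0 0 0 1.
Proof. by rewrite !mx3M; congr mx3; ring. Qed.

Lemma mx3_inj (a b c d e f g h i a' b' c' d' e' f' g' h' i' : R) :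
  mx3 a b c d e f g h i = mx3 a' b' c' d' e' f' g' h' i' ->
  [/\ [/\ a = a', b = b' & c = c'], [/\ d = d', e = e' & f = f']
    & [/\ g = g', h = h' & i = i']].
Proof.
move=> /matrixP E; split; split.
- by have := E 0 0; rewrite !mxE.
- by have := E 0 1; rewrite !mxE.
- by have := E 0 2%:R; rewrite !mxE.
- by have := E 1 0; rewrite !mxE.
- by have := E 1 1; rewrite !mxE.
- by have := E 1 2%:R; rewrite !mxE.
- by have := E 2%:R 0; rewrite !mxE.
- by have := E 2%:R 1; rewrite !mxE.
- by have := E 2%:R 2%:R; rewrite !mxE.
Qed.
End Matrix3.

Lemma F3_3 : (3%:R : 'F_3) = 0. Proof. by apply: val_inj. Qed.
Lemma F3_cube (a : 'F_3) : a ^+ 3 = a.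
Proof. by apply: val_inj; case: a => -[|[|[|]]]. Qed.

(** Newton's identity tr(A^3) = t^3 + 3 (D - t s) in characteristic 3, with
    x^3 = x on F_3. *)
Lemma mxtrace_cube_F3 (A : 'M['F_3]_3) : \tr (A *m A *m A) = \tr A.
Proof.
have [a [b [c [d [e [f [g [h [i ->]]]]]]]]] := mx3_eta A.
rewrite !mx3M !tr_mx3 -[RHS]F3_cube.
pose s := a * e + a * i + e * i - b * d - c * g - f * h.
pose D := a * (e * i - f * h) - b * (d * i - f * g) + c * (d * h - e * g).
transitivity ((a + e + i) ^+ 3 + 3%:R * (D - (a + e + i) * s)).
  by rewrite /s /D; ring.
by rewrite F3_3 mul0r addr0.
Qed.

(** The characteristic polynomial is X^3 - t X^2 + s X - D, where
    t^2 - tr(A^2) = 2 s = - s; the hypotheses make it X^3 - 1, which has the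
    root 1. *)
Lemma cube_eq1_F3 (A : 'M['F_3]_3) : \det A = 1 -> \tr A = 0 ->
  \tr (A *m A) = 0 -> A *m A *m A = 1%:M /\ \det (A - 1%:M) = 0.
Proof.
have [a [b [c [d [e [f [g [h [i ->]]]]]]]]] := mx3_eta A.
set M := mx3 _ _ _ _ _ _ _ _ _.
pose t := a + e + i.
pose s := a * e + a * i + e * i - b * d - c * g - f * h.
pose D := a * (e * i - f * h) - b * (d * i - f * g) + c * (d * h - e * g).
have CH : M *m M *m M = t *: (M *m M) - s *: M + D%:M.
  rewrite /M !mx3M mx3_scalar.
  by apply/matrixP=> -[[|[|[|//]]] ?] [[|[|[|//]]] ?];
    rewrite !mxE /= /t /s /D; ring.
have trM2 : \tr (M *m M) = t ^+ 2 + s - 3%:R * s.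
  by rewrite /M mx3M tr_mx3 /t /s; ring.
have detB : \det (M - 1%:M) = D - s + t - 1.
  by rewrite /M mx3_scalar mx3B det_mx3 /t /s /D; ring.
rewrite CH trM2 detB det_mx3 tr_mx3 -/D -/t => -> ->.
rewrite F3_3 mul0r subr0 expr0n add0r => ->.
by rewrite !scale0r subr0 add0r subr0 addr0 subrr.
Qed.

Lemma card_fixed_rV (F : finFieldType) n (A : 'M[F]_n) :
  #|[set v : 'rV_n | v *m A == v]| = (#|F| ^ (n - \rank (A - 1%:M)%R))%N.
Proof.
rewrite -mxrank_ker -card_rowg; apply: eq_card => v.
by rewrite inE mem_rowg (sameP sub_kermxP eqP) mulmxBr mulmx1 subr_eq0.
Qed.

(** A - 1 is singular and nonzero, so its kernel has dimension 1 or 2. *)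
Lemma card_fixed_F3 (A : 'M['F_3]_3) : A != 1%:M -> \det (A - 1%:M) = 0 ->
  #|[set v : 'rV_3 | v *m A == v]| = 3%N \/ #|[set v : 'rV_3 | v *m A == v]| = 9.
Proof.
move=> A1 detA; rewrite card_fixed_rV card_Fp //.
have r0 : \rank (A - 1%:M) != 0%N by rewrite mxrank_eq0 subr_eq0.
have r3 : \rank (A - 1%:M) != 3%N.
  by rewrite -[_ == _]/(row_free _) row_free_unit unitmxE detA unitr0.
have := rank_leq_row (A - 1%:M).
by move: (\rank _) r0 r3 => [|[|[|[|]]]] //; [right|left].
Qed.

(** A matrix commuting with the transvections I + E_12, I + E_23 and I + E_31
    is scalar, and a scalar a in F_3 with a^3 = 1 is 1. *)
Lemma center_SL33 : 'Z(SL 3 'F_3)%g = 1%g.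
Proof.
apply/eqP; rewrite eqEsubset sub1G andbT; apply/subsetP=> z /centerP[zSL zC].
have zcomm (A : 'M['F_3]_3) : \det A = 1 -> GLval z *m A = A *m GLval z.
  move=> dA; have UA : A \is a GRing.unit by rewrite -[_ \is a _]/(_ \in unitmx) unitmxE dA unitr1.
  pose a : {'GL_3['F_3]} := FinRing.Unit UA.
  have /zC : a \in SL 3 'F_3 by rewrite inE /= dA.
  by move=> /(congr1 GLval); rewrite !GL_ME.
have dz : \det (GLval z) = 1 by move: zSL; rewrite inE => /eqP.
rewrite inE; apply/eqP; apply: val_inj => /=.
move: (GLval z) zcomm dz => Z.
have [a [b [c [d [e [f [g [h [i ->]]]]]]]]] := mx3_eta Z => ZC.
have m12 := ZC (mx3 1 1 0 0 1 0 0 0 1); have m23 := ZC (mx3 1 0 0 0 1 1 0 0 1).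
have m31 := ZC (mx3 1 0 0 0 1 0 1 0 1); move: m12 m23 m31.
rewrite !mx3M !det_mx3 !(mulr0, mul0r, mulr1, mul1r, addr0, add0r, subr0, oppr0).
have cancel0 (x y : 'F_3) : x = x + y -> y = 0.
  by rewrite -[X in X = _ -> _]addr0 => /addrI.
have swap0 (x y : 'F_3) : x + y = y -> x = 0 by rewrite addrC => /esym/cancel0.
move=> /(_ erefl)/mx3_inj[[/cancel0 d0 ae /cancel0 f0] _ [_ /swap0 g0 _]].
move=> /(_ erefl)/mx3_inj[[_ _ /swap0 b0] [_ /cancel0 h0 ei] _].
move=> /(_ erefl)/mx3_inj[[/esym/cancel0 c0 _ _] _ _].
move: ae ei; rewrite d0 f0 g0 b0 h0 c0 !(addr0, add0r) => -> ->.
rewrite !(mulr0, mul0r, subr0, addr0) -expr2 -exprS F3_cube => ->.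
by rewrite -mx3_scalar.
Qed.

Lemma PSL33_rep : exists f : {morphism [set: PSL 3 'F_3] >-> {'GL_3['F_3]}},
  ('injm f)%g /\ (f @* [set: PSL 3 'F_3])%g = SL 3 'F_3.
Proof.
have : ([set: PSL 3 'F_3] \isog SL 3 'F_3)%g.
  rewrite isog_sym; apply: (isog_trans (quotient1_isog _)).
  by rewrite -center_SL33; apply: isog_subg.
by case/isogP=> f; exists f.
Qed.

Local Close Scope ring_scope.

(** * Finite p-subgroups of V(Z PSL(3,3)) under the Zassenhaus conjecture *)

Local Open Scope group_scope.

Local Notation G := (PSL 3 'F_3).

Lemma PSL33_natural_rep : exists rho : G -> 'M['F_3]_3,
  [/\ forall x y, rho (x * y) = (rho x *m rho y)%R, injective rho,
      forall x, (\det (rho x) = 1)%R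
    & forall A, (\det A = 1)%R -> exists x, rho x = A].
Proof.
have [f [injf imf]] := PSL33_rep.
exists (fun x => GLval (f x)); split.
- by move=> x y; rewrite morphM ?inE // GL_ME.
- by move=> x y e; apply: (injmP injf); rewrite ?inE //; apply: val_inj.
- move=> x; have : f x \in SL 3 'F_3 by rewrite -imf mem_morphim ?inE.
  by rewrite inE => /eqP.
move=> A dA; have UA : (A \is a GRing.unit)%R.
  by rewrite -[_ \is a _]/(_ \in unitmx) unitmxE dA unitr1.
pose a : {'GL_3['F_3]} := FinRing.Unit UA.
have : a \in SL 3 'F_3 by rewrite inE /= dA.
by rewrite -imf => /morphimP[x _ _ ax]; exists x; rewrite -ax.
Qed.

(** A Sylow 3-subgroup of GL(3,3) has order 27, and lies in SL(3,3) since the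
    determinant d of its elements satisfies d = d^27 = 1. *)
Lemma logn_card_PSL33 : logn 3 #|G| = 3.
Proof.
have [f [injf imf]] := PSL33_rep.
have -> : #|G| = #|SL 3 'F_3| by rewrite -imf card_injm // cardsT.
have oGL : #|'GL_3['F_3]| = (3 ^ 3 * 416)%N.
  by rewrite card_GL // card_Fp // unlock.
have l3 : logn 3 #|'GL_3['F_3]| = 3 by rewrite oGL.
have [S sylS] := Sylow_exists 3 'GL_3['F_3].
have oS : #|S| = 27 by rewrite (card_Hall sylS) p_part l3.
apply/eqP; rewrite eqn_leq; apply/andP; split.
  by rewrite -[X in _ <= X]l3 dvdn_leq_log ?cardG_gt0 // cardSg ?subsetT.
suff sS : S \subset SL 3 'F_3.
  by have /(dvdn_leq_log 3 (cardG_gt0 _)) := cardSg sS; rewrite oS.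
apply/subsetP=> x xS; rewrite inE.
have : (\det (GLval (x ^+ 27)%g) = 1)%R by rewrite -oS expg_cardG // det1.
have detX n : (\det (GLval (x ^+ n)%g) = \det (GLval x) ^+ n)%R.
  elim: n => [|n IH]; first by rewrite expg0 det1.
  by rewrite expgS GL_ME [X in X = _]det_mulmx IH exprS.
by rewrite detX -[27]/(3 * 3 * 3)%N !exprM !F3_cube => ->.
Qed.

Section NaturalRep.
Variable rho : G -> 'M['F_3]_3.
Hypothesis rhoM : forall x y, rho (x * y) = (rho x *m rho y)%R.
Hypothesis rho_inj : injective rho.
Hypothesis rho_det : forall x, (\det (rho x) = 1)%R.
Hypothesis rho_surj : forall A, (\det A = 1)%R -> exists x, rho x = A.

Lemma rho1 : rho 1 = 1%:M%R.
Proof.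
have [x x1] := rho_surj (det1 _ 3).
by rewrite -x1 -[in RHS](mulg1 x) rhoM x1 mul1mx.
Qed.

Lemma cube_eq1_rho x : (\tr (rho x) = 0)%R -> (\tr (rho (x ^+ 2)%g) = 0)%R ->
  x ^+ 3 = 1 /\ (\det (rho x - 1%:M) = 0)%R.
Proof.
rewrite expgS expg1 rhoM => tx tx2.
have [x3 d] := cube_eq1_F3 (rho_det x) tx tx2; split=> //.
by apply: rho_inj; rewrite rho1 -x3 -!rhoM !expgS expg0 mulg1 mulgA.
Qed.

(** The trace is invariant under cubing. *)
Lemma mxtrace_rho_3elt x k : x ^+ (3 ^ k) = 1 -> (\tr (rho x) = 0)%R.
Proof.
have -> : (\tr (rho x) = \tr (rho (x ^+ (3 ^ k))%g))%R.
  elim: k => [|k ->]; first by rewrite expn0 expg1.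
  rewrite expnSr expgM; set y := x ^+ _.
  by rewrite -mxtrace_cube_F3 -!rhoM !expgS expg0 mulg1 mulgA.
by move=> ->; rewrite rho1 mxtrace1 F3_3.
Qed.

Lemma PSL33_3elt x k : x ^+ (3 ^ k) = 1 ->
  x ^+ 3 = 1 /\ (\det (rho x - 1%:M) = 0)%R.
Proof.
move=> xk; apply: cube_eq1_rho; first exact: mxtrace_rho_3elt xk.
by apply: (mxtrace_rho_3elt (k := k)); rewrite -expgM mulnC expgM xk expg1n.
Qed.

Definition vec_act (v : 'rV['F_3]_3) (x : G) := (v *m rho x)%R.
Fact vec_act1 v : vec_act v 1 = v. Proof. by rewrite /vec_act rho1 mulmx1. Qed.
Fact vec_actM v x y : vec_act v (x * y) = vec_act (vec_act v x) y.
Proof. by rewrite /vec_act rhoM mulmxA. Qed.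
Definition vec_action : {action G &-> 'rV['F_3]_3} := TotalAction vec_act1 vec_actM.

Lemma card_fix1 : #|'Fix_vec_action[1]| = 27.
Proof.
rewrite (eq_card (B := 'rV['F_3]_3)) ?card_mx ?card_Fp // => v.
by rewrite [RHS]inE; apply/afix1P; apply: act1.
Qed.

Lemma card_fixV x : #|'Fix_vec_action[x^-1]| = #|'Fix_vec_action[x]|.
Proof. by rewrite -afix_cycle cycleV afix_cycle. Qed.

Lemma card_fix_3elt x k : x ^+ (3 ^ k) = 1 -> x <> 1 ->
  #|'Fix_vec_action[x]| = 3 \/ #|'Fix_vec_action[x]| = 9.
Proof.
move=> xk x1; have [_ d] := PSL33_3elt xk.
have -> : #|'Fix_vec_action[x]| = #|[set v : 'rV_3 | (v *m rho x)%R == v]|.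
  by apply: eq_card => v; rewrite !inE sub1set inE.
apply: card_fixed_F3 d; apply/eqP=> e; apply: x1.
by apply: rho_inj; rewrite rho1.
Qed.

(** That a Sylow 3-subgroup is not abelian follows from [no_rank3_fix_counts]:
    the group acts on F_3^3 as a permutation group, so the divisibility is the
    orbit counting formula. *)
Lemma PSL33_Sylow3 (P : {group G}) : 3.-Sylow([set: G]) P ->
  [/\ 3.-group P, #|P| = 27, exponent P %| 3 & ~~ abelian P].
Proof.
move=> sylP; have pP := pHall_pgroup sylP.
have oP : #|P| = 27 by rewrite (card_Hall sylP) p_part cardsT logn_card_PSL33.
have eltP x : x \in P -> x ^+ (3 ^ 3) = 1.
  by move=> xP; rewrite -[(3 ^ 3)%N]oP expg_cardG.
have expP : exponent P %| 3.
  by apply/exponentP=> x /eltP/PSL33_3elt[].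
split=> //; apply/negP=> cPP.
apply: (@no_rank3_fix_counts _ P (fun x => #|'Fix_vec_action[x]|)) => //.
- by rewrite abelemE // cPP.
- exact: card_fix1.
- by move=> x /setD1P[x1 xP]; apply: card_fix_3elt (eltP x xP) _; apply/eqP.
- by move=> x _; apply: card_fixV.
move=> H _; have aH : [acts H, on [set: 'rV['F_3]_3] | vec_action].
  by apply/subsetP=> x _; rewrite !inE; apply/subsetP=> v; rewrite !inE.
rewrite (eq_bigr (fun x => #|'Fix_([set: 'rV['F_3]_3] | vec_action)[x]|)).
  by rewrite (Frobenius_Cauchy aH) dvdn_mull.
by move=> x _; rewrite setTI.
Qed.

Section UnitSubgroup.
Variables (hT : finGroupType) (phi : hT -> normalized_unit G int) (c : hT -> G).
Hypothesis phiM : {morph phi : x y / x * y}.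
Hypothesis phi_inj : injective phi.
Hypothesis phi_c : forall x, rat_conj (phi x) (c x).

(** Exponent 3 and order at most 27 leave the elementary abelian groups and the
    extraspecial one; [no_rank3_fix_counts], for the numbers of fixed vectors of
    the c x, excludes rank three. *)
Lemma unit_3group_embeds : 3.-group [set: hT] ->
  exists f : {morphism [set: hT] >-> G}, 'injm f.
Proof.
move=> pU; have [P sylP] := Sylow_exists 3 [set: G].
have [pP oP expP ncP] := PSL33_Sylow3 sylP.
suff [Q _ isoQ] : exists2 Q : {group G}, Q \subset [set: G] & [set: hT] \isog Q.
  by have /isogP[f injf _] := isoQ; exists f.
have [k oU] := p_natP pU; rewrite cardsT in oU.
have k3 : k <= 3.
  rewrite -logn_card_PSL33 -(pfactorK k (isT : prime 3)) -oU.
  apply: dvdn_leq_log; first by rewrite -cardsT cardG_gt0.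
  exact: dvdn_card_unit_subgroup phiM phi_inj phi_c.
have cX (x : hT) : c x ^+ (3 ^ k) = 1.
  by apply: (conj_expg1 phiM phi_c); rewrite -oU -cardsT expg_cardG ?inE.
have expU : exponent [set: hT] %| 3.
  apply/exponentP=> x _; apply: (conj_expg_eq1 phiM phi_inj phi_c).
  by have [] := PSL33_3elt (cX x).
have [cUU|ncU] := boolP (abelian [set: hT]); last first.
  have lU : logn 3 #|[set: hT]| = k by rewrite cardsT oU pfactorK.
  have k_eq3 : k = 3.
    apply/eqP; rewrite eqn_leq k3 ltnNge; apply: contra ncU => k2.
    by apply: p2group_abelian pU _; rewrite lU.
  exists P => //.
  have esU : extraspecial [set: hT] by apply: p3group_extraspecial pU ncU _; rewrite lU.
  have esP : extraspecial P by apply: p3group_extraspecial pP ncP _; rewrite oP.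
  apply: isog_trans (isog_pX1p2 _ esU expU _) _ => //; first by rewrite cardsT oU k_eq3.
  by rewrite isog_sym; apply: isog_pX1p2.
have abU : 3.-abelem [set: hT] by rewrite abelemE // cUU.
have k2 : k <= 2.
  rewrite -ltnS ltn_neqAle k3 andbT; apply/eqP=> k_eq3.
  apply: (@no_rank3_fix_counts _ [set: hT]%G (fun x => #|'Fix_vec_action[c x]|)) => //.
  - by rewrite cardsT oU k_eq3.
  - have := conj_expg1 phiM phi_c (expg1 1); rewrite expg1 => ->.
    exact: card_fix1.
  - move=> x /setD1P[x1 _]; apply: card_fix_3elt (cX x) _ => cx.
    by case/eqP: x1; rewrite -[x]expg1; apply: (conj_expg_eq1 phiM phi_inj phi_c).
  (* c need not commute with inversion, but x^-1 is a power of x, and powers of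
     x are rationally conjugate to the powers of c x. *)
  - move=> x _; rewrite -[RHS]card_fixV.
    have -> : (c x)^-1 = c x ^+ #[x].-1.
      apply: (mulgI (c x)); rewrite mulgV -expgS prednK ?order_gt0 //.
      by rewrite (conj_expg1 phiM phi_c) ?expg_order.
    rewrite invg_expg; apply/eqP; rewrite -(eqr_nat rat).
    apply/eqP; apply: (conj_classfunX phiM phi_c (tau :=
      fun x => #|'Fix_vec_action[x]|%:R%R : rat)) => y z.
    by rewrite card_afix1J.
  - by move=> H _; apply: (dvdn_sum_card_fix phiM phi_c).
have [Q [sQP _ oQ]] : exists Q : {group G}, [/\ Q \subset P, Q <| P & #|Q| = (3 ^ k)%N].
  by apply: normal_pgroup pP (normal_refl P) _; rewrite oP (pfactorK 3).
exists Q; rewrite ?subsetT // (isog_abelem_card _ abU) cardsT oU oQ eqxx andbT.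
rewrite abelemE // (p2group_abelian (pgroupS sQP pP)) ?oQ ?pfactorK //=.
exact: dvdn_trans (exponentS sQP) expP.
Qed.

(** Reduction modulo 3 of U followed by A |-> det(A) A. *)
Lemma unit_p'group_embeds p : prime p -> p != 3 -> p.-group [set: hT] ->
  exists f : {morphism [set: hT] >-> G}, 'injm f.
Proof.
move=> p_pr p3 pU; pose A x := gr_lin rho (phi x).
have AM x y : A (x * y) = (A x *m A y)%R by rewrite /A phiM gr_linM.
have A1 : A 1 = 1%:M%R by rewrite /A (unit_morph1 phiM) gr_lin1 rho1.
have detA x : (\det (A x) ^+ 2 = 1)%R.
  have : (\det (A x) * \det (A x^-1%g) = 1)%R by rewrite -det_mulmx -AM mulgV A1 det1.
  move: (\det _)%R => d; have [->|d0] := eqVneq d 0%R.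
    by rewrite mul0r => /esym/eqP; rewrite oner_eq0.
  by move=> _; apply: (mulfI d0); rewrite -exprS F3_cube mulr1.
pose B x := (\det (A x) *: A x)%R.
have detB x : (\det (B x) = 1)%R.
  by rewrite /B detZ -exprSr -[4]/(2 * 2)%N exprM detA expr1n.
have BM x y : B (x * y) = (B x *m B y)%R.
  by rewrite /B AM det_mulmx -scalemxAl -scalemxAr scalerA mulrC.
have [f rf] := fin_all_exists (fun x => rho_surj (detB x)).
have fM : {in [set: hT] &, {morph f : x y / x * y}}.
  by move=> x y _ _; apply: rho_inj; rewrite rhoM !rf BM.
exists (Morphism fM); apply/injmP=> x y _ _ /= fxy.
suff ker z : f z = 1 -> z = 1.
  apply/eqP; rewrite eq_mulgV1; apply/eqP/ker.
  pose F := Morphism fM; rewrite -[f]/(F : hT -> G) morphM ?morphV ?inE //=.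
  by rewrite fxy mulgV.
move=> fz; have Bz : B z = 1%:M%R by rewrite -rf fz rho1.
have Az : A z = ((\det (A z))%:M)%R.
  by rewrite -scalemx1 -Bz /B scalerA -expr2 detA scale1r.
have tA (a : 'F_3) : (\tr (a%:M : 'M_3) = 0)%R.
  by rewrite mxtrace_scalar -mulr_natr F3_3 mulr0.
have trz : (\tr (rho (c z)) = 0)%R.
  by rewrite -(mxtrace_gr_lin rhoM (phi_c z)) -/(A z) Az tA.
have trz2 : (\tr (rho (c z ^+ 2)%g) = 0)%R.
  rewrite -(mxtrace_gr_lin rhoM (rat_conjX 2 (phi_c z))).
  rewrite -(nu_val_morphX phiM) -/(A _) expgS expg1 AM Az -scalar_mxM.
  by rewrite tA.
have [cz3 _] := cube_eq1_rho trz trz2.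
have z3 := conj_expg_eq1 phiM phi_inj phi_c cz3.
have : #[z] %| gcdn #|[set: hT]| 3 by rewrite dvdn_gcd order_dvdG ?inE // order_dvdn z3 eqxx.
have /eqP-> : coprime #|[set: hT]| 3.
  by apply: pnat_coprime pU _; rewrite p'natE // dvdn_prime2.
by rewrite dvdn1 order_eq1 => /eqP.
Qed.
End UnitSubgroup.
End NaturalRep.

Lemma zassenhaus_weak_sylow_PSL33 : zassenhaus_conjecture G -> weak_sylow_like G.
Proof.
move=> ZC p p_pr U clU pU; pose hT := fset_group clU.
pose phi (x : hT) : normalized_unit G int := val x.
have phiM : {morph phi : x y / x * y} by [].
have phi_inj : injective phi by apply: val_inj.
have pT : p.-group [set: hT] by rewrite /pgroup cardsT -cardfE.
have conjP (x : hT) : exists g, rat_conj (phi x) g.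
  have [|w [wU [g wg]]] := ZC (phi x); last by exists g, w.
  exists #[x]; first exact: order_gt0.
  have phi1 := unit_morph1 phiM.
  have -> : phi x ^+ #[x] = phi (x ^+ #[x]).
    elim: #[x] => [|n IH]; first by rewrite !expg0 phi1.
    by rewrite !expgS IH phiM.
  by rewrite expg_order phi1.
have [c phi_c] := fin_all_exists conjP.
have [rho [rhoM rho_inj rho_det rho_surj]] := PSL33_natural_rep.
suff [f injf] : exists f : {morphism [set: hT] >-> G}, 'injm f.
  exists (f @* [set: hT])%G; first exact: morphim_pgroup.
  exact: fsubgroup_isogP.
have [p3|p3] := eqVneq p 3.
  rewrite p3 in pT; exact: (unit_3group_embeds rhoM rho_inj rho_det rho_surj phiM phi_inj phi_c).
exact: (unit_p'group_embeds rhoM rho_inj rho_det rho_surj phiM phi_inj phi_c p_pr p3 pT).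
Qed.

Local Close Scope group_scope.

(** * Averages over subgroups *)

Local Open Scope ring_scope.

Section GroupAverage.
Variable gT : finGroupType.
Local Notation QG := (group_ring gT rat).
Implicit Types (u v : QG) (x y : gT) (A : {set gT}) (H : {group gT}).

Lemma gr_ofMl x u : gr_of rat x * u = [ffun y => u (x^-1 * y)%g] :> QG.
Proof.
apply/ffunP=> y; rewrite !ffunE (bigD1 x) //= ffunE eqxx mul1r.
by rewrite big1 ?addr0 // => z /negPf zx; rewrite ffunE zx mul0r.
Qed.

Lemma gr_ofMr x u : u * gr_of rat x = [ffun y => u (y * x^-1)%g] :> QG.
Proof.
apply/ffunP=> y; rewrite !ffunE (bigD1 (y * x^-1)%g) //= ffunE.
rewrite invMg invgK mulgKV eqxx mulr1 big1 ?addr0 // => z zx.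
rewrite ffunE; case: eqP => [zy|_]; last by rewrite mulr0.
by rewrite -zy invMg invgK mulKVg eqxx in zx.
Qed.

Definition average A : QG := [ffun x => (x \in A)%:R / #|A|%:R].

Lemma card_rat_neq0 H : #|H|%:R != 0 :> rat.
Proof. by rewrite pnatr_eq0 -lt0n cardG_gt0. Qed.

(** Left multiplication by avg(H) averages the translates of u. *)
Lemma averageMl H u :
  (forall x, x \in H -> gr_of rat x * u = u) -> average H * u = u.
Proof.
move=> Hu; apply/ffunP=> y; rewrite ffunE.
under eq_bigr => x _.
  have -> : average H x * u (x^-1 * y)%g = (x \in H)%:R * (u y / #|H|%:R).
    rewrite ffunE mulrAC -mulrA; case: (boolP (x \in H)) => xH; last by rewrite !mul0r.
    by rewrite -[in RHS](Hu x xH) gr_ofMl ffunE.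
  over.
rewrite -mulr_suml -natr_sum -big_mkcond sum1_card /=.
by rewrite mulrC mulfVK // card_rat_neq0.
Qed.

Lemma average_absorb H x : x \in H -> gr_of rat x * average H = average H.
Proof.
by move=> xH; rewrite gr_ofMl; apply/ffunP=> y; rewrite !ffunE groupMl ?groupV.
Qed.

Lemma averageC H x : x \in ('N(H))%g ->
  average H * gr_of rat x = gr_of rat x * average H.
Proof.
move=> xN; rewrite gr_ofMl gr_ofMr; apply/ffunP=> y; rewrite !ffunE.
by rewrite -(memJ_norm (y * x^-1)%g xN) conjgE mulgKV.
Qed.

Lemma average_absorbr H x : x \in H -> average H * gr_of rat x = average H.
Proof. by move=> xH; rewrite averageC ?average_absorb // (subsetP (normG H)). Qed.

Lemma average_mul_sub H (K : {group gT}) : H \subset K -> average H * average K = average K.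
Proof. by move=> sHK; apply: averageMl => x xH; rewrite average_absorb ?(subsetP sHK). Qed.

Lemma average_comm H u :
  (forall x, x \in H -> gr_of rat x * u = u * gr_of rat x) ->
  average H * u = u * average H.
Proof.
move=> Hu; apply/ffunP=> y; rewrite !ffunE.
rewrite [RHS](reindex_inj (inj_comp (mulgI y) invg_inj)) /=.
apply: eq_bigr => x _; rewrite !ffunE invMg invgK mulgKV.
have [xH|_] := boolP (x \in H); last by rewrite !mul0r mulr0.
have /ffunP/(_ y) := Hu x xH; rewrite gr_ofMl gr_ofMr !ffunE => ->.
by rewrite mulrC.
Qed.

Lemma augmentationD u v : augmentation (u + v) = augmentation u + augmentation v.
Proof. by rewrite -big_split; apply: eq_bigr => x _; rewrite ffunE. Qed.

Lemma augmentationB u v : augmentation (u - v) = augmentation u - augmentation v.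
Proof. by rewrite -sumrB; apply: eq_bigr => x _; rewrite !ffunE. Qed.

Lemma augmentation_average H : augmentation (average H) = 1.
Proof.
rewrite /augmentation; under eq_bigr do rewrite ffunE.
by rewrite -mulr_suml -natr_sum -big_mkcond sum1_card divff // card_rat_neq0.
Qed.

Lemma augmentation_gr_of x : augmentation (gr_of rat x) = 1.
Proof.
rewrite /augmentation (bigD1 x) //= ffunE eqxx big1 ?addr0 // => y /negPf yx.
by rewrite ffunE yx.
Qed.

Lemma partial_augmentationB x u v : partial_augmentation x (u - v) =
  partial_augmentation x u - partial_augmentation x v.
Proof. by rewrite -sumrB; apply: eq_bigr => y _; rewrite !ffunE. Qed.

Lemma partial_augmentation_sum x (I : finType) (F : I -> QG) :
  partial_augmentation x (\sum_i F i) = \sum_i partial_augmentation x (F i).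
Proof.
rewrite /partial_augmentation exchange_big /=; apply: eq_bigr => y _.
by rewrite sum_ffunE.
Qed.

Lemma partial_augmentation_gr_of x y :
  partial_augmentation x (gr_of rat y) = (y \in x ^: [set: gT])%g%:R.
Proof.
rewrite /partial_augmentation; under eq_bigr do rewrite ffunE.
have [yx|yx] := boolP (y \in _).
  by rewrite (bigD1 y) //= eqxx big1 ?addr0 // => z /andP[_ /negPf ->].
by rewrite big1 // => z zx; case: eqP => // zy; rewrite -zy zx in yx.
Qed.

Lemma partial_augmentation_average x H y :
  partial_augmentation x (average H * gr_of rat y) =
    #|(x ^: [set: gT] :&: H :* y)%g|%:R / #|H|%:R.
Proof.
rewrite gr_ofMr /partial_augmentation -sum1_card natr_sum mulr_suml.
rewrite [RHS](eq_bigl (fun z => (z \in x ^: [set: gT])%g && (z \in H :* y)%g)).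
  rewrite big_mkcondr; apply: eq_bigr => z _; rewrite !ffunE mem_rcoset.
  by case: (_ \in H); rewrite ?mul0r.
by move=> z; rewrite inE.
Qed.

Lemma rcoset_stable H z : {in H & (H :* z)%g, forall a y, (a * y)%g \in (H :* z)%g}.
Proof.
by move=> a y aH yH; rewrite mem_rcoset -mulgA groupMl // -mem_rcoset.
Qed.

Lemma natr_div3_int n : (3 %| n)%N -> n%:R / 3%:R \is a @Num.int rat.
Proof. by case/dvdnP=> q ->; rewrite natrM mulfK. Qed.

(** S is a union of right cosets of H; inversion turns the left translations
    into the right regular action. *)
Lemma dvdn_card_stable (H : {group gT}) (S : {set gT}) :
  {in H & S, forall a y, (a * y)%g \in S} -> (#|H| %| #|S|)%N.
Proof.
move=> HS; rewrite -[#|S|]card_invg.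
have aH : [acts H, on S^-1 | 'R]%g.
  apply/subsetP=> a aH; rewrite !inE; apply/subsetP=> y; rewrite !inE /= => yS.
  by rewrite invMg HS ?groupV.
rewrite -(acts_sum_card_orbit aH); elim/big_ind: _ => //; first exact: dvdn_add.
by move=> _ /imsetP[y _ ->]; rewrite orbitR card_lcoset.
Qed.

End GroupAverage.

(** * Units twisted along the lines of a group of order 9 *)

(** The construction of part (b) in an arbitrary finite group.  Here L is one of
    the four subgroups of order 3 of N, g acts trivially on N modulo L, and the
    four conjugates L^(h_i) are all the lines of N, as [lines] expresses: each
    nontrivial element of N lies on exactly one of them. *)
Section LineTwistedUnits.
Variables (gT : finGroupType) (N L : {group gT}) (g : gT) (h : 'I_4 -> gT).
Local Notation QG := (group_ring gT rat).
Hypotheses (cNN : abelian N) (oN : #|N| = 9%N) (oL : #|L| = 3%N) (sLN : L \subset N).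
Hypothesis hN : forall i, h i \in ('N(N))%g.
Let Ln i : {group gT} := (L :^ h i)%G.
Let x i : gT := (g ^ h i)%g.
Hypothesis lines : forall n, n \in (N^#)%g -> (\sum_(i < 4) (n \in Ln i) = 1)%N.
Hypothesis gN : g \in ('N(N))%g.
Hypothesis g3 : (g ^+ 3 = 1)%g.
Hypothesis g_comm : forall n, n \in N -> exists2 l, l \in L & (g * n = l * (n * g))%g.
Hypothesis fuse : forall k l, (0 < k < 3)%N -> l \in L ->
  exists2 n, n \in N & ((g ^+ k) ^ n = l * g ^+ k)%g.
Hypothesis ord3 : forall n k, (0 < k < 3)%N -> n \in N -> #[(n * g ^+ k)%g]%g = 3%N.
Hypothesis N3 : forall n, n \in (N^#)%g -> #[n]%g = 3%N.

Lemma sub_lineN i : Ln i \subset N.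
Proof. by rewrite /= -(normP (hN i)) conjSg. Qed.

Lemma card_line i : #|Ln i| = 3%N.
Proof. by rewrite /= cardJg. Qed.

Lemma lineN_conj i n : n \in N -> exists2 m, m \in N & n = (m ^ h i)%g.
Proof. by move=> nN; exists (n ^ (h i)^-1)%g; rewrite ?memJ_norm ?groupV ?conjgKV. Qed.

Lemma norm_line i n : n \in N -> n \in ('N(Ln i))%g.
Proof. exact: subsetP (sub_abelian_norm cNN (sub_lineN i)) n. Qed.

Lemma line_inter i j : i != j -> (Ln i :&: Ln j = 1)%g.
Proof.
move=> ij; apply/trivgP/subsetP=> n; rewrite inE => /andP[ni nj].
have [->|n1] := eqVneq n 1%g; first exact: group1.
have nN : n \in (N^#)%g by rewrite !inE n1 (subsetP (sub_lineN i)).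
have := lines nN; rewrite (bigD1 i) //= (bigD1 j) 1?eq_sym //=.
by rewrite ni nj.
Qed.

Lemma averageN_line i : average N * average (Ln i) = average N.
Proof.
rewrite -average_comm ?average_mul_sub ?sub_lineN // => a ai.
by rewrite averageC // (subsetP (normG N)) // (subsetP (sub_lineN i)).
Qed.

(** Two distinct lines span N. *)
Lemma average_lineM i j : i != j -> average (Ln i) * average (Ln j) = average N.
Proof.
move=> ij; have NE : (Ln i * Ln j)%g = N.
  apply/eqP; rewrite eqEcard mul_subG ?sub_lineN //.
  by rewrite TI_cardMg ?line_inter // !card_line oN.
have cij : average (Ln i) * average (Ln j) = average (Ln j) * average (Ln i).
  by apply: average_comm => a ai; rewrite averageC // norm_line // (subsetP (sub_lineN i)).
have absN : average N * (average (Ln i) * average (Ln j)) =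
    average (Ln i) * average (Ln j).
  apply: averageMl => n; rewrite -NE => /mulsgP[a b ai bj ->].
  rewrite gr_ofM -mulrA cij (mulrA (gr_of rat b)) average_absorb // -cij.
  by rewrite mulrA average_absorb.
by rewrite -absN mulrA !averageN_line.
Qed.

(** The index 0 stands for the trivial character of N, and i + 1 for the pair of
    conjugate characters with kernel L_i.  K j is that kernel, E j the
    corresponding rational idempotent, and X j acts trivially on N modulo
    K j. *)
Let K (j : 'I_5) : {group gT} := if unlift ord0 j is Some i then Ln i else N.
Let E (j : 'I_5) : QG :=
  if unlift ord0 j is Some i then average (Ln i) - average N else average N.
Let X (j : 'I_5) : gT := if unlift ord0 j is Some i then x i else g.

Lemma idemM j k : E j * E k = if j == k then E j else 0.
Proof.
rewrite /E; case: (unliftP ord0 j) => [i|] ->; case: (unliftP ord0 k) => [i'|] -> //.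
- rewrite (inj_eq lift_inj) mulrBr !mulrBl !averageN_line.
  rewrite (@average_mul_sub _ (Ln i) N) ?sub_lineN // (@average_mul_sub _ N N) // subrr subr0.
  case: eqP => [->|/eqP ii']; first by rewrite average_mul_sub.
  by rewrite average_lineM // subrr.
- by rewrite mulrBl average_mul_sub ?sub_lineN // average_mul_sub // subrr.
- by rewrite mulrBr averageN_line average_mul_sub // subrr.
by rewrite eqxx average_mul_sub.
Qed.

(** Each nontrivial element of N lies on one line and the identity on four, so
    the sum of the four avg(L_i) is 1 + 3 avg(N). *)
Lemma sum_idem : \sum_j E j = 1.
Proof.
rewrite big_ord_recl /E unlift_none; under eq_bigr do rewrite liftK.
apply/ffunP=> y; rewrite ffunE sum_ffunE.
under eq_bigr => i _ do rewrite !ffunE oN card_line.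
rewrite !ffunE oN sumrB -mulr_suml -natr_sum sumr_const card_ord.
have [yN|yN] := boolP (y \in N); last first.
  rewrite big1 => [|i _]; last by apply/eqP; rewrite eqb0; apply: contra yN; apply/subsetP/sub_lineN.
  by rewrite (_ : _ == _ = false) //; apply: contraNF yN => /eqP ->; apply: group1.
have [->|y1] := eqVneq y 1%g.
  by under eq_bigr do rewrite group1; rewrite sum1_card card_ord.
by rewrite lines ?inE ?y1.
Qed.

Lemma norm_g : g \in ('N(L))%g.
Proof.
rewrite -groupV inE; apply/subsetP=> _ /imsetP[l lL ->].
have [l' l'L e] := g_comm (subsetP sLN l lL).
by rewrite conjgE invgK mulgA e mulgA mulgK groupM.
Qed.

Lemma X_normN j : X j \in ('N(N))%g.
Proof. by rewrite /X; case: unlift => // i; rewrite groupJ. Qed.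

Lemma X_normK j : X j \in ('N(K j))%g.
Proof.
rewrite /X /K; case: unlift => [i|//].
by rewrite /= normJ memJ_conjg norm_g.
Qed.

Lemma X3 j : (X j ^+ 3 = 1)%g.
Proof. by rewrite /X; case: unlift => // i; rewrite -conjXg g3 conj1g. Qed.

Lemma sub_K j : K j \subset N.
Proof. by rewrite /K; case: unlift => // i; apply: sub_lineN. Qed.

(** By induction on k, as conjugation by X j preserves K j. *)
Lemma X_comm j k n : n \in N ->
  exists2 c, c \in K j & (X j ^+ k * n = c * (n * X j ^+ k))%g.
Proof.
move=> nN; have X_comm1 : exists2 c, c \in K j & (X j * n = c * (n * X j))%g.
  rewrite /X /K; case: unlift => [i|]; last first.
    exists (n ^ (g^-1) * n^-1)%g; last by rewrite conjgE invgK !mulgA mulgKV mulgKV.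
    by rewrite groupM ?groupV // memJ_norm // groupV.
  have [m mN ->] := lineN_conj i nN.
  have [l lL e] := g_comm mN; exists (l ^ h i)%g; first by rewrite memJ_conjg.
  by rewrite -!conjMg e.
have [c cK e1] := X_comm1; elim: k => [|k [d dK e]].
  by exists 1%g; rewrite ?group1 // expg0 !mul1g mulg1.
exists (d ^ (X j)^-1 * c)%g.
  by rewrite groupM // memJ_norm // groupV X_normK.
rewrite expgS -mulgA e conjgE invgK.
rewrite -!mulgA; congr (_ * (_ * _))%g.
by rewrite (mulgA n (X j)) (mulgA c) -e1 -mulgA mulKg.
Qed.

Lemma idemC j y : y \in N \/ y = X j -> E j * gr_of rat y = gr_of rat y * E j.
Proof.
move=> yP; have yN : y \in ('N(N))%g.
  by case: yP => [yN|->]; [rewrite (subsetP (normG N)) | apply: X_normN].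
have := X_normK j; move: yP; rewrite /E /K /X; case: unlift => [i|_ _]; last by rewrite averageC.
move=> yP xiN; rewrite mulrBl mulrBr !averageC //.
by case: yP => [/norm_line|->].
Qed.

Lemma idem_absorb j c : c \in K j -> E j * gr_of rat c = E j.
Proof.
rewrite /E /K; case: unlift => [i|] cK; last exact: average_absorbr.
by rewrite mulrBl !average_absorbr // (subsetP (sub_lineN i)).
Qed.

Let Y n k j := (n * X j ^+ k)%g.
(** The element n t^k, with t the sum of the E j X j. *)
Definition line_unit n k : QG := \sum_j E j * gr_of rat (Y n k j).

Lemma idemYC j n k : n \in N -> E j * gr_of rat (Y n k j) = gr_of rat (Y n k j) * E j.
Proof.
move=> nN; rewrite /Y gr_ofM mulrA (idemC (or_introl nN)) -!mulrA; congr (_ * _).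
elim: k => [|k IH]; first by rewrite expg0 mulr1 mul1r.
by rewrite expgS gr_ofM mulrA (idemC (or_intror erefl)) -mulrA IH mulrA.
Qed.

(** Moving E j across, only the diagonal terms survive; in those, n and X j
    commute up to an element of K j, which E j absorbs. *)
Lemma line_unitM n k m l : n \in N -> m \in N ->
  line_unit n k * line_unit m l = line_unit (n * m) (k + l).
Proof.
move=> nN mN; rewrite /line_unit mulr_suml; apply: eq_bigr => j _.
rewrite mulr_sumr (bigD1 j) //= big1 => [|i ij]; last first.
  by rewrite idemYC // -mulrA (mulrA (E j)) idemM eq_sym (negPf ij) mul0r mulr0.
rewrite addr0 idemYC // -mulrA (mulrA (E j)) idemM eqxx mulrA -idemYC // -mulrA -gr_ofM.
have [c cK e] := X_comm j k mN.
have -> : (Y n k j * Y m l j = c * Y (n * m) (k + l) j)%g.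
  rewrite /Y -!mulgA (mulgA (X j ^+ k)%g) e expgD !mulgA; congr (_ * _ * _ * _)%g.
  by rewrite (centsP cNN) // (subsetP (sub_K j)).
by rewrite gr_ofM mulrA idem_absorb.
Qed.

Lemma line_unit0 n : line_unit n 0 = gr_of rat n.
Proof.
rewrite /line_unit; under eq_bigr do rewrite /Y expg0 mulg1.
by rewrite -mulr_suml sum_idem mul1r.
Qed.

Lemma line_unit_mod n k : line_unit n (k %% 3) = line_unit n k.
Proof. by apply: eq_bigr => j _; rewrite /Y expg_mod // X3. Qed.

Lemma augmentation_line_unit n k : augmentation (line_unit n k) = 1.
Proof.
rewrite /line_unit big_ord_recl augmentationD {1}/E unlift_none augmentationM.
rewrite augmentation_average augmentation_gr_of mulr1 -[RHS]addr0; congr (_ + _).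
elim/big_rec: _ => [|i u _ IH]; first by rewrite /augmentation big1 // => y; rewrite ffunE.
rewrite augmentationD IH addr0 augmentationM {1}/E liftK.
by rewrite augmentationB !augmentation_average subrr mul0r.
Qed.

(** Conjugating y by N multiplies it by an arbitrary element of [N, y], which is
    the line K j. *)
Lemma coset_fusion j k a y : (0 < k < 3)%N -> a \in K j -> y \in (N :* X j ^+ k)%g ->
  j != ord0 -> (a * y)%g \in (y ^: [set: gT])%g.
Proof.
rewrite /K /X => k3; case: (unliftP ord0 j) => [i ->|-> //] ai yN _.
have base l z : l \in L -> z \in (N :* g ^+ k)%g -> exists w, (z ^ w = l * z)%g.
  move=> lL /rcosetP[m mN ->]; have [n nN e] := fuse k3 lL.
  exists n; rewrite conjMg e conjgE (centsP cNN m mN n nN) mulKg.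
  by rewrite !mulgA (centsP cNN m mN l (subsetP sLN l lL)).
move: ai yN => /imsetP[l lL ->] /rcosetP[m /(lineN_conj i)[m' m'N ->] ->].
rewrite -conjXg -!conjMg; have [|w e] := base l (m' * g ^+ k)%g lL.
  by rewrite mem_rcoset mulgK.
apply/imsetP; exists (w ^ h i)%g; first by rewrite inE.
by rewrite -conjJg e.
Qed.

Lemma card_class_coset c j k :
  #|(c ^: [set: gT] :&: N :* X j ^+ k)%g| = #|(c ^: [set: gT] :&: N :* g ^+ k)%g|.
Proof.
rewrite /X; case: unlift => // i.
have CJ : ((c ^: [set: gT]) :^ h i = c ^: [set: gT])%g.
  by apply/normP; rewrite (subsetP (class_norm _ _)) ?inE.
by rewrite -[RHS](cardJg _ (h i)) conjIg CJ conjsMg conjg_set1 conjXg (normP (hN i)).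
Qed.

Lemma class_coset_stable c j k (H : {group gT}) (B : {set gT}) :
    (0 < k < 3)%N -> j != ord0 -> H \subset K j ->
    {in H & B, forall a y, (a * y)%g \in B} -> B \subset (N :* X j ^+ k)%g ->
  (#|H| %| #|(c ^: [set: gT])%g :&: B|)%N.
Proof.
move=> k3 j0 sHK HB sBN; apply: dvdn_card_stable => a y aH; rewrite !inE => /andP[yc yB].
rewrite HB // andbT -(class_eqP yc).
exact: coset_fusion k3 (subsetP sHK a aH) (subsetP sBN y yB) j0.
Qed.

(** The five averages over N contribute |S| / 9 - 4 |S| / 9 = - |S| / 3 and the
    averages over the lines |T i| / 3, where 3 divides |S| and every |T i| by
    [coset_fusion]. *)
Lemma partial_augmentation_line_unit c n k : n \in N -> (0 < k < 3)%N ->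
  partial_augmentation c (line_unit n k) \is a Num.int.
Proof.
move=> nN k3; pose S := (c ^: [set: gT] :&: N :* g ^+ k)%g.
have NY j : (N :* Y n k j = N :* X j ^+ k)%g by rewrite /Y rcosetM rcoset_id.
have N_E j : partial_augmentation c (average N * gr_of rat (Y n k j)) =
    #|S|%:R / 9%:R.
  by rewrite partial_augmentation_average NY card_class_coset oN.
have S3 : (3 %| #|S|)%N.
  pose j : 'I_5 := lift ord0 (ord0 : 'I_4).
  rewrite -(card_class_coset c j) -(card_line ord0).
  apply: class_coset_stable k3 _ _ _ (subxx _) => // [|a y aL yN].
    by rewrite /K liftK.
  by apply: rcoset_stable yN; apply: subsetP aL; apply: sub_lineN.
pose T i := (c ^: [set: gT] :&: Ln i :* Y n k (lift ord0 i))%g.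
have T3 i : (3 %| #|T i|)%N.
  rewrite -(card_line i); apply: (class_coset_stable c (j := lift ord0 i)) k3 _ _ _ _ => //.
  - by rewrite /K liftK.
  - exact: rcoset_stable.
  by rewrite -NY mulSg ?sub_lineN.
rewrite partial_augmentation_sum big_ord_recl {1}/E unlift_none N_E.
rewrite (eq_bigr (fun i => #|T i|%:R / 3%:R - #|S|%:R / 9%:R)) => [|i _]; last first.
  rewrite /E liftK mulrBl partial_augmentationB N_E partial_augmentation_average.
  by rewrite card_line.
rewrite sumrB sumr_const card_ord.
have -> : #|S|%:R / 9%:R + (\sum_i #|T i|%:R / 3%:R - (#|S|%:R / 9%:R) *+ 4) =
    \sum_i #|T i|%:R / 3%:R - #|S|%:R / 3%:R :> rat.
  set A := \sum_i _; set B : rat := #|S|%:R.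
  by rewrite -mulr_natr; field.
by rewrite rpredB ?rpred_sum ?natr_div3_int // => i _; rewrite natr_div3_int.
Qed.

(** The support of n t^k lies in the cosets N g_i^k, which consist of elements
    of order 3. *)
Lemma partial_augmentation_line_unit0 c n k : n \in N -> (0 < k < 3)%N ->
  #[c]%g != 3%N -> partial_augmentation c (line_unit n k) = 0.
Proof.
move=> nN k3 oc.
have C0 (H : {group gT}) j : H \subset N ->
    partial_augmentation c (average H * gr_of rat (Y n k j)) = 0.
  move=> sHN; rewrite partial_augmentation_average.
  suff -> : (c ^: [set: gT] :&: H :* Y n k j = set0)%g by rewrite cards0 mul0r.
  apply/setP=> y; rewrite inE in_set0; apply/negbTE/andP=> -[/imsetP[w _ ->]].
  case/rcosetP=> a aH /(congr1 (fun z => #[z]%g)); rewrite orderJ => ocE.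
  case/negP: oc; rewrite ocE /Y mulgA; set m := (a * n)%g.
  have mN : m \in N by rewrite groupM // (subsetP sHN).
  rewrite /X; case: unlift => [i|]; last by rewrite ord3.
  have [m' m'N ->] := lineN_conj i mN.
  by rewrite -conjXg -conjMg orderJ ord3.
rewrite partial_augmentation_sum big1 // => j _; rewrite /E; case: unlift => [i|].
  by rewrite mulrBl partial_augmentationB !C0 ?subrr ?sub_lineN.
exact: C0.
Qed.

Let hT : finGroupType := ([subg N] * 'Z_3)%type.
Let word (u : hT) : QG := line_unit (sgval u.1) u.2.

Lemma wordM u v : word (u * v)%g = word u * word v.
Proof.
by rewrite line_unitM ?subgP //= -line_unit_mod.
Qed.

Lemma word1 : word 1%g = 1.
Proof. by rewrite /word line_unit0. Qed.

Lemma word_unit u : word u \is a GRing.unit.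
Proof. by apply/unitrP; exists (word u^-1%g); rewrite -!wordM mulVg mulgV word1. Qed.

Lemma word_nu_subproof u : (word u \is a GRing.unit) && (augmentation (word u) == 1).
Proof. by rewrite word_unit augmentation_line_unit eqxx. Qed.
Definition word_nu u : normalized_unit gT rat := NormalizedUnit (word_nu_subproof u).

Lemma word_partial_augmentation u c : u != 1%g ->
  (#[c]%g = 3%N -> partial_augmentation c (word u) \is a Num.int) /\
  (#[c]%g <> 3%N -> partial_augmentation c (word u) = 0).
Proof.
case: u => n k u1; rewrite /word /=.
have [k0|k0] := eqVneq k 0; last first.
  have k3 : (0 < k < 3)%N by rewrite lt0n k0 ltn_ord.
  split=> [_|/eqP oc]; first exact: partial_augmentation_line_unit (subgP n) k3.
  exact: partial_augmentation_line_unit0 (subgP n) k3 oc.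
rewrite k0 line_unit0.
have n1 : sgval n \in (N^#)%g.
  rewrite !inE subgP andbT; apply: contraNneq u1 => n1.
  by rewrite k0; apply/eqP; congr (_, _); apply: val_inj.
have paE : partial_augmentation c (gr_of rat (sgval n)) =
    (sgval n \in c ^: [set: gT])%g%:R.
  exact: partial_augmentation_gr_of.
rewrite paE; split=> [_|oc]; first exact: rpred_nat.
case: (boolP (_ \in _)) => // /imsetP[w _ nc].
by case: oc; rewrite -(N3 n1) nc orderJ.
Qed.

(** A nontrivial element in the kernel would have partial augmentation 0 at the
    class of 1. *)
Lemma word_nu_inj : injective word_nu.
Proof.
move=> u v /(congr1 (@nu_val _ _)) /= uv; apply/eqP; rewrite eq_mulgV1.
apply: contraT => uv1; have [_ pa0] := word_partial_augmentation 1%g uv1.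
have := pa0 _; rewrite order1 => /(_ ltac:(by [])) /eqP.
by rewrite wordM uv -wordM mulgV word1 partial_augmentation_gr_of class_refl oner_eq0.
Qed.

Lemma exists_line_unit_group : exists U : {fset normalized_unit gT rat},
    [/\ group_closed [in U],
        (exists (hT : finGroupType) (E : {group hT}),
           [/\ (3.-abelem E)%g, #|E| = 27%N & fsubgroup_isog U E])
      & forall u : normalized_unit gT rat, u \in U -> u <> 1%g ->
        forall x : gT,
          (#[x]%g = 3%N -> partial_augmentation x u \is a Num.int) /\
          (#[x]%g <> 3%N -> partial_augmentation x u = 0)].
Proof.
have phiM : {morph word_nu : u v / (u * v)%g}.
  by move=> u v; apply: val_inj; apply: wordM.
have [clU isoU] := fsubgroup_isog_imfset phiM word_nu_inj.
exists [fset word_nu x | x in hT]%fset; split=> //.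
  exists hT, [set: hT]%G; split=> //; last first.
    by rewrite cardsT card_prod card_ord -(cardsT [subg N]) -(card_isog (isog_subg N)) oN.
  rewrite abelemE //; apply/andP; split.
    apply/centsP=> -[n k] _ [m l] _; congr (_, _); last exact: Zp_mulgC.
    by apply: val_inj; apply: (centsP cNN); apply: subgP.
  apply/exponentP=> -[n k] _.
  have pairX (a : [subg N]) (b : 'Z_3) i : (((a, b) : hT) ^+ i = (a ^+ i, b ^+ i))%g.
    by elim: i => [|i IH] //; rewrite !expgS IH.
  rewrite pairX; congr (_, _).
    apply: val_inj; rewrite [LHS](morphX (sgval_morphism N)) ?inE //=.
    have [->|n1] := eqVneq (sgval n) 1%g; first by rewrite expg1n.
    by rewrite -[3%N](N3 (_ : sgval n \in (N^#)%g)) ?expg_order // !inE n1 subgP.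
  by rewrite Zp_expg; apply: val_inj; rewrite /= modnMl.
move=> _ /imfsetP[u _ ->] u1 c; apply: word_partial_augmentation.
by apply/eqP=> u1'; apply: u1; rewrite u1'; apply: val_inj; apply: word1.
Qed.
End LineTwistedUnits.

Local Close Scope ring_scope.

(** * An elementary abelian subgroup of order 27 of V(Q PSL(3,3)) *)

Local Open Scope ring_scope.

(** The translations form the unipotent radical of a parabolic subgroup, on which
    diag(det A, A) acts by v |-> det(A) v A.  The shear is a transvection of this
    plane with axis spanned by (0, 1), and the element called singer induces a
    Singer cycle, of order 8, whose powers permute the four lines of the plane
    cyclically. *)
Section Concrete.
Variable rho : G -> 'M['F_3]_3.
Hypothesis rhoM : forall x y, rho (x * y)%g = rho x *m rho y.
Hypothesis rho_inj : injective rho.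
Hypothesis rho_det : forall x, \det (rho x) = 1.
Hypothesis rho_surj : forall A, \det A = 1 -> exists x, rho x = A.

Variables (transl : 'F_3 * 'F_3 -> G) (shear singer : G).
Hypothesis rho_transl : forall v, rho (transl v) = mx3 1 v.1 v.2 0 1 0 0 0 1.
Hypothesis rho_shear : rho shear = mx3 1 0 0 0 1 1 0 0 1.
Hypothesis rho_singer : rho singer = mx3 (-1) 0 0 0 0 1 0 1 1.

Lemma translM v w : (transl v * transl w)%g = transl (v + w).
Proof.
apply: rho_inj; rewrite rhoM !rho_transl mx3M /=; congr mx3; ring.
Qed.

Lemma transl_inj : injective transl.
Proof.
by move=> [a b] [c d] /(congr1 rho); rewrite !rho_transl /= => /mx3_inj[[_ -> ->]].
Qed.

Lemma transl0 : transl 0 = 1%g.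
Proof. by apply: (mulgI (transl 0)); rewrite translM addr0 mulg1. Qed.

Definition translations := [set transl v | v : 'F_3 * 'F_3].
Definition center_line := [set transl (0, b) | b : 'F_3].

Fact group_set_translations : group_set translations.
Proof.
apply/group_setP; split=> [|_ _ /imsetP[v _ ->] /imsetP[w _ ->]].
  by apply/imsetP; exists 0; rewrite ?transl0.
by apply/imsetP; exists (v + w); rewrite ?translM.
Qed.
Canonical translations_group := Group group_set_translations.

Fact group_set_center_line : group_set center_line.
Proof.
apply/group_setP; split=> [|_ _ /imsetP[v _ ->] /imsetP[w _ ->]].
  by apply/imsetP; exists 0; rewrite -?transl0.
apply/imsetP; exists (v + w); rewrite // translM; congr transl.
by apply/eqP; rewrite xpair_eqE eqxx andbT.
Qed.
Canonical center_line_group := Group group_set_center_line.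

Lemma shear_conj v : (transl v ^ shear)%g = transl (v.1, v.1 + v.2).
Proof.
apply: (mulgI shear); rewrite conjgE mulKVg; apply: rho_inj.
by rewrite !rhoM !rho_transl rho_shear shear_conj_mx.
Qed.

Lemma singer_conj v : (transl v ^ singer)%g = transl (- v.2, - (v.1 + v.2)).
Proof.
apply: (mulgI singer); rewrite conjgE mulKVg; apply: rho_inj.
by rewrite !rhoM !rho_transl rho_singer singer_conj_mx.
Qed.

Lemma singer_conjV v : (transl v ^ singer^-1)%g = transl (v.1 - v.2, - v.1).
Proof.
apply: (canLR (conjgK singer)); rewrite singer_conj /=; case: v => a b /=.
by rewrite opprK addrAC subrr sub0r opprK.
Qed.

Lemma singer_conjVX v i :
  (transl v ^ (singer ^+ i)^-1)%g = transl (iter i (fun w => (w.1 - w.2, - w.1)) v).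
Proof.
elim: i => [|i IH]; first by rewrite expg0 invg1 conjg1.
by rewrite expgS invMg conjgM IH singer_conjV.
Qed.

Lemma mem_center_line v : (transl v \in center_line) = (v.1 == 0).
Proof.
apply/imsetP/eqP=> [[b _ /transl_inj -> //]|v0].
by exists v.2; rewrite // -v0; case: v {v0}.
Qed.

Lemma rho_shearX k : rho (shear ^+ k)%g = mx3 1 0 0 0 1 k%:R 0 0 1.
Proof.
elim: k => [|k IH]; first by rewrite expg0 (rho1 rhoM rho_surj) mx3_scalar.
by rewrite expgS rhoM IH rho_shear mx3M -natr1; congr mx3; ring.
Qed.

(** Both traces in [cube_eq1_rho] are 3 = 0. *)
Lemma unitriangular_cube x a b c : rho x = mx3 1 a b 0 1 c 0 0 1 -> (x ^+ 3 = 1)%g.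
Proof.
have t0 : 1 + 1 + 1 = 0 :> 'F_3 by apply: val_inj.
move=> e; have [] := cube_eq1_rho rhoM rho_inj rho_det rho_surj (x := x) _ _ => //.
  by rewrite e tr_mx3.
rewrite expgS expg1 rhoM e mx3M tr_mx3 -[RHS]t0; ring.
Qed.

Lemma unitriangular_order x a b c : rho x = mx3 1 a b 0 1 c 0 0 1 ->
  (a, b, c) != 0 -> #[x]%g = 3%N.
Proof.
move=> e abc; apply: nt_prime_order => //; first exact: unitriangular_cube e.
apply: contraNneq abc => x1; move: e; rewrite x1 (rho1 rhoM rho_surj) mx3_scalar.
by move=> /mx3_inj[[_ <- <-] [_ _ <-] _].
Qed.

Lemma rho_transl_shearX v k :
  rho (transl v * shear ^+ k)%g = mx3 1 v.1 (v.1 * k%:R + v.2) 0 1 k%:R 0 0 1.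
Proof. by rewrite rhoM rho_transl rho_shearX mx3M; congr mx3; ring. Qed.

Lemma singer_norm : singer \in ('N(translations))%g.
Proof.
rewrite inE; apply/subsetP=> _ /imsetP[_ /imsetP[v _ ->] ->].
by rewrite singer_conj; apply: imset_f.
Qed.

Lemma shear_norm : shear \in ('N(translations))%g.
Proof.
rewrite inE; apply/subsetP=> _ /imsetP[_ /imsetP[v _ ->] ->].
by rewrite shear_conj; apply: imset_f.
Qed.

Lemma lines_partition n : n \in (translations^#)%g ->
  (\sum_(i < 4) (n \in center_line :^ (singer ^+ i))%g = 1)%N.
Proof.
move=> /setD1P[n1 /imsetP[v _ nv]]; subst n.
have v0 : v != 0 by apply: contraNneq n1 => ->; rewrite transl0.
under eq_bigr => i _ do rewrite mem_conjg singer_conjVX mem_center_line.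
rewrite !big_ord_recl big_ord0; move: v v0 {n1} => [a b].
by case: a => -[|[|[|//]]] ?; case: b => -[|[|[|//]]] ?.
Qed.

Lemma PSL33_rational_rank3 : exists U : {fset normalized_unit G rat},
    [/\ group_closed [in U],
        (exists (hT : finGroupType) (E : {group hT}),
           [/\ (3.-abelem E)%g, #|E| = 27%N & fsubgroup_isog U E])
      & forall u : normalized_unit G rat, u \in U -> u <> 1%g ->
        forall x : G,
          (#[x]%g = 3%N -> partial_augmentation x u \is a Num.int) /\
          (#[x]%g <> 3%N -> partial_augmentation x u = 0)].
Proof.
apply: (@exists_line_unit_group _ translations_group center_line_group shear
  (fun i => singer ^+ i)%g).
- by apply/centsP=> _ /imsetP[v _ ->] _ /imsetP[w _ ->]; rewrite /commute !translM addrC.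
- by rewrite /= card_imset ?card_prod ?card_Fp //; apply: transl_inj.
- rewrite /= card_imset ?card_Fp // => b c /transl_inj.
  by case.
- by apply/subsetP=> _ /imsetP[b _ ->]; apply: imset_f.
- by move=> i; rewrite groupX // singer_norm.
- exact: lines_partition.
- exact: shear_norm.
- exact: unitriangular_cube rho_shear.
- move=> _ /imsetP[v _ ->]; exists (transl (0, - v.1)); first exact: imset_f.
  rewrite mulgA translM -[shear]expg1; apply: rho_inj.
  rewrite rho_transl_shearX rhoM rho_transl rho_shearX mx3M /=.
  by congr mx3; ring.
- move=> k _ k3 /imsetP[c _ ->].
  have kk : k%:R * k%:R = 1 :> 'F_3 by apply: val_inj; case: k k3 => [|[|[|]]].
  (* Conjugating shear^k by the translation (a, 0) multiplies it by the
     translation (0, - k a), and k^2 = 1 in F_3. *)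
  exists (transl (- c * k%:R, 0)); first exact: imset_f.
  apply: (mulgI (transl (- c * k%:R, 0))); rewrite conjgE mulKVg mulgA translM.
  apply: rho_inj; rewrite rho_transl_shearX rhoM rho_transl rho_shearX mx3M /=.
  rewrite !addr0 !add0r -mulrA kk.
  by congr mx3; ring.
- move=> _ k k3 /imsetP[v _ ->].
  apply: (unitriangular_order (rho_transl_shearX v k)).
  by rewrite !xpair_eqE; case: k k3 => [|[|[|]]] //; rewrite andbF.
move=> n /setD1P[n1 /imsetP[v _ nv]]; subst n.
apply: (unitriangular_order (rho_transl v)).
apply: contraNneq n1 => -[v1 v2]; rewrite -transl0; apply/eqP; congr transl.
by case: v v1 v2 => a b /= -> ->.
Qed.
End Concrete.

Local Close Scope ring_scope.

Theorem proposition4p3 :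
  (zassenhaus_conjecture (PSL 3 'F_3) -> weak_sylow_like (PSL 3 'F_3)) /\
  (exists U : {fset normalized_unit (PSL 3 'F_3) rat},
    [/\ group_closed [in U],
        (exists (hT : finGroupType) (E : {group hT}),
           [/\ (3.-abelem E)%g, #|E| = 27 & fsubgroup_isog U E])
      & forall u : normalized_unit (PSL 3 'F_3) rat, u \in U -> u <> 1%g ->
        forall x : PSL 3 'F_3,
          (#[x]%g = 3 -> partial_augmentation x u \is a Num.int) /\
          (#[x]%g <> 3 -> partial_augmentation x u = 0%R)]).
Proof.
split; first exact: zassenhaus_weak_sylow_PSL33.
have [rho [rhoM rho_inj rho_det rho_surj]] := PSL33_natural_rep.
have det_transl (v : 'F_3 * 'F_3) : (\det (mx3 1 v.1 v.2 0 1 0 0 0 1) = 1)%R.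
  by rewrite det_mx3; ring.
have [transl rho_transl] := fin_all_exists (fun v => rho_surj _ (det_transl v)).
have [|shear rho_shear] := rho_surj (mx3 1 0 0 0 1 1 0 0 1)%R.
  by rewrite det_mx3; ring.
have [|singer rho_singer] := rho_surj (mx3 (-1) 0 0 0 0 1 0 1 1)%R.
  by rewrite det_mx3; ring.
exact: (PSL33_rational_rank3 rhoM rho_inj rho_det rho_surj
  rho_transl rho_shear rho_singer).
Qed.
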